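(* Let $\mu_x,\mu_y>0$, $L_x>\mu_x$, $L_y>\mu_y$, $L_{xy}>0$, and let $\mathcal{A}$ be any algorithm from the general pure first-order algorithm class. Let $B_x,B_y,\alpha,\beta,q,A,b$ and $$F(x,y)=\tfrac12 x^\top (B_xA^2 + \mu_xI)x + \tfrac{L_{xy}}{2}x^\top Ay - \tfrac12 y^\top (B_yA^2 + \mu_yI)y - b^\top y$$ on $\mathbb{R}^n\times\mathbb{R}^n$ be as specified in the context, with saddle point $(x^*,y^* )$, and for orthogonal matrices $U,V\in\mathbb{R}^{n\times n}$ let $F_{U,V}(x,y)=F(Ux,Vy)$. Assume the dimension $n$ is sufficiently large. Then for any positive integer $k$ there exist orthogonal matrices $U,V$ such that $F_{U,V}\in\mathcal{F}(L_x,L_y,L_{xy},\mu_x,\mu_y)$ and, when $\mathcal{A}$ is applied to $F_{U,V}$ with initial solution $(x^0,y^0)=(0,0)$, the iterates and the output satisfy $$\{(x^0,y^0),\dots,(x^k,y^k)\}\subseteq U^\top\mathcal{H}_x^{2k}\times V^\top\mathcal{H}_y^{2k}\quad\text{and}\quad(\tilde x^k,\tilde y^k)\in U^\top\mathcal{H}_x^{2k+1}\times V^\top\mathcal{H}_y^{2k+1}.$$ Consequently, $$\|\tilde x^k-U^\top x^*\|^2 \geq \frac{q^{4k+2}}{16}\|x^*-x^0\|^2.$$ As a result, it takes $\Omega\Big(\sqrt{\frac{L_x}{\mu_x} + \frac{L_{xy}^2}{\mu_x\mu_y} + \frac{L_y}{\mu_y}}\cdot\ln\big(\frac{1}{\epsilon}\big)\Big)$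 iterations to output a solution with $O(\epsilon)$ duality gap.
   Context: Class $\mathcal{F}(L_x,L_y,L_{xy},\mu_x,\mu_y)$: problems $\min_x\max_yF(x,y)$ with $F$ smooth, $F(\cdot,y)$ $\mu_x$-strongly convex for each $y$, $F(x,\cdot)$ $\mu_y$-strongly concave for each $x$, and for all arguments $\|\nabla_xF(x_1,y)-\nabla_xF(x_2,y)\|\le L_x\|x_1-x_2\|$, $\|\nabla_yF(x,y_1)-\nabla_yF(x,y_2)\|\le L_y\|y_1-y_2\|$, $\|\nabla_xF(x,y_1)-\nabla_xF(x,y_2)\|\le L_{xy}\|y_1-y_2\|$, $\|\nabla_yF(x_1,y)-\nabla_yF(x_2,y)\|\le L_{xy}\|x_1-x_2\|$. General pure first-order algorithm class: let $\theta=(L_x,L_y,L_{xy},\mu_x,\mu_y)$. An algorithm $\mathcal{A}$ consists of a sequence of deterministic mappings $\mathcal{A}_x^1,\mathcal{A}_y^1,\mathcal{A}_x^2,\mathcal{A}_y^2,\dots$ such that, when applied to a problem with objective $G$ from any initial $(x^0,y^0)$, iterates $(x^k,y^k)$ and outputs $(\tilde x^k,\tilde y^k)$ are generated by $$(x^k,\tilde x^k)=\mathcal{A}_x^k\big(\theta;x^0,\nabla_xG(x^0,y^0),\dots,x^{k-1},\nabla_xG(x^{k-1},y^{k-1})\big),$$ $$(y^k,\tilde y^k)=\mathcal{A}_y^k\big(\theta;y^0,\nabla_yG(x^0,y^0),\dots,y^{k-1},\nabla_yG(x^{k-1},y^{k-1})\big).$$ Instance: $B_x=\frac{L_x-\mu_x}{4}$,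 $B_y=\frac{L_y-\mu_y}{4}$, $\alpha=\frac{L_{xy}^2}{4B_xB_y}+\frac{\mu_x}{B_x}+\frac{\mu_y}{B_y}$, $\beta=\frac{\mu_x\mu_y}{B_xB_y}$; $q$ is a real root of $1-(4+\alpha)x+(6+2\alpha+\beta)x^2-(4+\alpha)x^3+x^4=0$ satisfying $$1-\left(\tfrac12 +\tfrac{1}{2\sqrt{2}}\sqrt{\tfrac{L_x}{\mu_x} + \tfrac{L_{xy}^2}{\mu_x\mu_y} + \tfrac{L_y}{\mu_y}}\right)^{-1}<q<1 - \left(\tfrac12 +\tfrac{1}{2}\sqrt{\tfrac{L_{xy}^2}{\mu_x\mu_y} + \tfrac{L_x}{\mu_x} + \tfrac{L_y}{\mu_y}-1}\right)^{-1};$$ $A\in\mathbb{R}^{n\times n}$ has $A_{i,n+1-i}=1$ for $1\le i\le n$, $A_{i,n+2-i}=-1$ for $2\le i\le n$, other entries $0$ (it is invertible); $b=\frac{2B_xB_y}{L_{xy}}A^{-1}\hat b$ with $\hat b_1=(2+\alpha+\beta)q-(3+\alpha)q^2+q^3$, $\hat b_2=q-1$, $\hat b_i=0$ for $3\le i\le n$. The saddle point of $F_{U,V}$ is $(U^\top x^*,V^\top y^* )$. Subspaces: $\mathcal{H}_x^1=\{0\}$, $\mathcal{H}_x^j=\mathrm{Span}\{A^{2i}(Ab):0\le i\le j-2\}$ for $j\ge2$, $\mathcal{H}_y^j=\mathrm{Span}\{A^{2i}b:0\le i\le j-1\}$ for $j\ge1$. The duality gap of $(\tilde x,\tilde y)$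 for $G$ is $\max_yG(\tilde x,y)-\min_xG(x,\tilde y)$. ''Sufficiently large'' $n$ may depend on $k$ and the parameters. In the $\Omega$ statement absolute constants are hidden, $\epsilon\to0$, and problem-dependent factors inside the logarithm are suppressed.
   Formalization: In the Ω bound the hidden constant is uniform only over parameters with L_x/μ_x + L_xy²/(μ_xμ_y) + L_y/μ_y ≥ κ0, for each fixed κ0 > 2, since no constant works uniformly as this sum tends to 2 (gradient steps then contract arbitrarily fast). *)

(* Defs.v *)
From HB Require Import structures.
From mathcomp Require Import all_boot all_order all_algebra.
From mathcomp Require Import all_classical all_reals all_analysis.

Set Implicit Arguments.
Unset Strict Implicit.
Unset Printing Implicit Defensive.

Import Order.TTheory GRing.Theory Num.Theory numFieldNormedType.Exports.
Local Open Scope classical_set_scope.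
Local Open Scope ring_scope.

(* The canonical norm `|x| on matrices is the max norm, hence the explicit
   Euclidean norm; differentiability does not depend on this choice. *)
Definition enorm (R : realType) (n : nat) (x : 'cV[R]_n) : R :=
  Num.sqrt (\sum_(i < n) x i ord0 ^+ 2).

Definition grad (R : realType) (n : nat) (f : 'cV[R]_n -> R) (x : 'cV[R]_n) :
    'cV[R]_n :=
  \col_(i < n) derive f x (delta_mx i ord0).

Definition gradx (R : realType) (n m : nat) (G : 'cV[R]_n -> 'cV[R]_m -> R)
    (x : 'cV[R]_n) (y : 'cV[R]_m) : 'cV[R]_n := grad (fun u => G u y) x.

Definition grady (R : realType) (n m : nat) (G : 'cV[R]_n -> 'cV[R]_m -> R)
    (x : 'cV[R]_n) (y : 'cV[R]_m) : 'cV[R]_m := grad (G x) y.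

Definition strongly_convex (R : realType) (n : nat) (mu : R)
    (f : 'cV[R]_n -> R) : Prop :=
  forall (u v : 'cV[R]_n) (t : R), 0 <= t <= 1 ->
    f (t *: u + (1 - t) *: v) <=
      t * f u + (1 - t) * f v - mu / 2 * t * (1 - t) * enorm (u - v) ^+ 2.

Definition strongly_concave (R : realType) (n : nat) (mu : R)
    (f : 'cV[R]_n -> R) : Prop := strongly_convex mu (fun x => - f x).

Record params (R : realType) := Params {
  Lx : R; Ly : R; Lxy : R; mux : R; muy : R }.

Definition valid_params (R : realType) (th : params R) : Prop :=
  [/\ 0 < mux th, 0 < muy th, mux th < Lx th, muy th < Ly th & 0 < Lxy th].

(* Joint differentiability together with the four Lipschitz bounds makes G
   continuously differentiable. *)
Record problem_class (R : realType) (n m : nat) (th : params R)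
    (G : 'cV[R]_n -> 'cV[R]_m -> R) : Prop := ProblemClass {
  pc_smooth : forall p : 'cV[R]_n * 'cV[R]_m,
    differentiable (fun z : 'cV[R]_n * 'cV[R]_m => G z.1 z.2) p;
  pc_convex : forall y, strongly_convex (mux th) (fun x => G x y);
  pc_concave : forall x, strongly_concave (muy th) (G x);
  pc_lip_xx : forall x1 x2 y,
    enorm (gradx G x1 y - gradx G x2 y) <= Lx th * enorm (x1 - x2);
  pc_lip_yy : forall x y1 y2,
    enorm (grady G x y1 - grady G x y2) <= Ly th * enorm (y1 - y2);
  pc_lip_xy : forall x y1 y2,
    enorm (gradx G x y1 - gradx G x y2) <= Lxy th * enorm (y1 - y2);
  pc_lip_yx : forall x1 x2 y,
    enorm (grady G x1 y - grady G x2 y) <= Lxy th * enorm (x1 - x2) }.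

(* [alg_x A k th h] is the pair (next iterate, output) of step k >= 1; the
   history h lists the pairs (iterate, partial gradient) for steps 0 .. k - 1. *)
Record algorithm (R : realType) (n m : nat) := Algorithm {
  alg_x : nat -> params R -> seq ('cV[R]_n * 'cV[R]_n) -> 'cV[R]_n * 'cV[R]_n;
  alg_y : nat -> params R -> seq ('cV[R]_m * 'cV[R]_m) -> 'cV[R]_m * 'cV[R]_m }.

Definition history_x (R : realType) (n m : nat)
    (G : 'cV[R]_n -> 'cV[R]_m -> R) (s : seq ('cV[R]_n * 'cV[R]_m)) :=
  [seq (z.1, gradx G z.1 z.2) | z <- s].

Definition history_y (R : realType) (n m : nat)
    (G : 'cV[R]_n -> 'cV[R]_m -> R) (s : seq ('cV[R]_n * 'cV[R]_m)) :=
  [seq (z.2, grady G z.1 z.2) | z <- s].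

Definition step_x (R : realType) (n m : nat) (A : algorithm R n m)
    (th : params R) (G : 'cV[R]_n -> 'cV[R]_m -> R) (k : nat)
    (s : seq ('cV[R]_n * 'cV[R]_m)) := alg_x A k th (history_x G s).

Definition step_y (R : realType) (n m : nat) (A : algorithm R n m)
    (th : params R) (G : 'cV[R]_n -> 'cV[R]_m -> R) (k : nat)
    (s : seq ('cV[R]_n * 'cV[R]_m)) := alg_y A k th (history_y G s).

(* The list (x^0, y^0), ..., (x^k, y^k). *)
Fixpoint trajectory (R : realType) (n m : nat) (A : algorithm R n m)
    (th : params R) (G : 'cV[R]_n -> 'cV[R]_m -> R)
    (z0 : 'cV[R]_n * 'cV[R]_m) (k : nat) : seq ('cV[R]_n * 'cV[R]_m) :=
  if k is k'.+1 then
    let s := trajectory A th G z0 k' in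
    rcons s ((step_x A th G k s).1, (step_y A th G k s).1)
  else [:: z0].

Definition iterate (R : realType) (n m : nat) (A : algorithm R n m)
    (th : params R) (G : 'cV[R]_n -> 'cV[R]_m -> R)
    (z0 : 'cV[R]_n * 'cV[R]_m) (k : nat) : 'cV[R]_n * 'cV[R]_m :=
  last z0 (trajectory A th G z0 k).

(* Only meaningful for k >= 1: there is no output at step 0. *)
Definition output (R : realType) (n m : nat) (A : algorithm R n m)
    (th : params R) (G : 'cV[R]_n -> 'cV[R]_m -> R)
    (z0 : 'cV[R]_n * 'cV[R]_m) (k : nat) : 'cV[R]_n * 'cV[R]_m :=
  let s := trajectory A th G z0 k.-1 in
  ((step_x A th G k s).2, (step_y A th G k s).2).

(* Valued in \bar R so that no boundedness is needed; on the problem class both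
   extrema are attained. *)
Definition duality_gap (R : realType) (n m : nat)
    (G : 'cV[R]_n -> 'cV[R]_m -> R) (z : 'cV[R]_n * 'cV[R]_m) : \bar R :=
  (ereal_sup (range (fun y => (G z.1 y)%:E)) -
   ereal_inf (range (fun x => (G x z.2)%:E)))%E.

Definition saddle_point (R : realType) (n m : nat)
    (G : 'cV[R]_n -> 'cV[R]_m -> R) (xs : 'cV[R]_n) (ys : 'cV[R]_m) : Prop :=
  forall x y, G xs y <= G xs ys /\ G xs ys <= G x ys.

Definition Bx (R : realType) (th : params R) : R := (Lx th - mux th) / 4.
Definition By (R : realType) (th : params R) : R := (Ly th - muy th) / 4.

Definition alpha (R : realType) (th : params R) : R :=
  Lxy th ^+ 2 / (4 * Bx th * By th) + mux th / Bx th + muy th / By th.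

Definition beta (R : realType) (th : params R) : R :=
  mux th * muy th / (Bx th * By th).

Definition kappa (R : realType) (th : params R) : R :=
  Lx th / mux th + Lxy th ^+ 2 / (mux th * muy th) + Ly th / muy th.

Definition hard_root (R : realType) (th : params R) (q : R) : Prop :=
  let a := alpha th in let b := beta th in
  [/\ 1 - (4 + a) * q + (6 + 2 * a + b) * q ^+ 2 - (4 + a) * q ^+ 3
        + q ^+ 4 = 0,
      1 - (1 / 2 + 1 / (2 * Num.sqrt 2) * Num.sqrt (kappa th))^-1 < q &
      q < 1 - (1 / 2 + 1 / 2 *
            Num.sqrt (Lxy th ^+ 2 / (mux th * muy th) + Lx th / mux th
                      + Ly th / muy th - 1))^-1].

(* Indices are shifted to start at 0: the 1-based antidiagonal j = n + 1 - i is
   i + j + 1 = n, and j = n + 2 - i is i + j = n. *)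
Definition hard_A (R : realType) (n : nat) : 'M[R]_n :=
  \matrix_(i < n, j < n)
    (if (i + j).+1 == n then 1 else if (i + j)%N == n then - 1 else 0).

Definition hard_bhat (R : realType) (n : nat) (th : params R) (q : R) :
    'cV[R]_n :=
  \col_(i < n)
    (if val i == 0%N then
       (2 + alpha th + beta th) * q - (3 + alpha th) * q ^+ 2 + q ^+ 3
     else if val i == 1%N then q - 1 else 0).

Definition hard_b (R : realType) (n : nat) (th : params R) (q : R) :
    'cV[R]_n :=
  (2 * Bx th * By th / Lxy th) *: (invmx (hard_A R n) *m hard_bhat n th q).

(* The value u^T M v of a bilinear form. *)
Definition bilin (R : realType) (n m : nat) (M : 'M[R]_(n, m)) (u : 'cV[R]_n)
    (v : 'cV[R]_m) : R := (u^T *m M *m v) ord0 ord0.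

Definition hard_F (R : realType) (n : nat) (th : params R) (q : R)
    (x y : 'cV[R]_n) : R :=
  let A := hard_A R n in
  1 / 2 * bilin (Bx th *: A ^+ 2 + (mux th)%:M) x x
  + Lxy th / 2 * bilin A x y
  - 1 / 2 * bilin (By th *: A ^+ 2 + (muy th)%:M) y y
  - ((hard_b n th q)^T *m y) ord0 ord0.

Definition hard_FUV (R : realType) (n : nat) (th : params R) (q : R)
    (U V : 'M[R]_n) (x y : 'cV[R]_n) : R := hard_F th q (U *m x) (V *m y).

Definition orthogonal_mx (R : realType) (n : nat) (U : 'M[R]_n) : Prop :=
  U *m U^T = 1%:M.

(* For j = 1 the list is empty and the span is 0. *)
Definition krylov_x (R : realType) (n : nat) (th : params R) (q : R)
    (j : nat) : {vspace 'cV[R]_n} :=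
  <<[seq hard_A R n ^+ (2 * i) *m (hard_A R n *m hard_b n th q)
      | i <- iota 0 j.-1]>>%VS.

Definition krylov_y (R : realType) (n : nat) (th : params R) (q : R)
    (j : nat) : {vspace 'cV[R]_n} :=
  <<[seq hard_A R n ^+ (2 * i) *m hard_b n th q | i <- iota 0 j]>>%VS.

(* The set (U^T H_x^j) x (V^T H_y^j). *)
Definition rotated_krylov (R : realType) (n : nat) (th : params R) (q : R)
    (U V : 'M[R]_n) (j : nat) : set ('cV[R]_n * 'cV[R]_n) :=
  (mulmx U^T @` [set` krylov_x n th q j]) `*`
  (mulmx V^T @` [set` krylov_y n th q j]).

(* Main.v *)
(* In F, the y-part of the optimality system can be eliminated, and x* solves
   (A^4 + alpha A^2 + beta) x* = bhat with A^2 tridiagonal. The vector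
   (q, q^2, q^3, ...) solves this system except for a defect of size O(q^n) in
   the last two rows, so x* is within O(q^n) of it, whereas the members of the
   Krylov subspace H_x^{2k+1} vanish beyond entry 2k+1: their distance to x* is
   at least the tail of a geometric sequence.

   An adversary keeps every algorithm inside these subspaces. When the iterates
   so far lie in U^T H^{2j}, their gradients lie in U^T H^{2j+1}; the next
   iterate and the next output can be forced into the images of H^{2j+2} and
   H^{2j+3} by composing with reflections that fix H^{2j+1}, hence the whole
   past.

   Strong convexity turns the distance into a duality gap of order q^{4j}, and
   ln (1/q) = O(1/sqrt kappa) by the lower bound on q. *)

Require Import Defs.
From HB Require Import structures.
From mathcomp Require Import all_boot all_order all_algebra.
From mathcomp Require Import all_classical all_reals all_analysis.
From mathcomp Require Import ring lra zify.

Set Implicit Arguments.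
Unset Strict Implicit.
Unset Printing Implicit Defensive.

Import Order.TTheory GRing.Theory Num.Theory numFieldNormedType.Exports.
Local Open Scope classical_set_scope.
Local Open Scope ring_scope.

(** * Orthogonal matrices *)

Definition dot (R : realType) (n : nat) (u v : 'cV[R]_n) : R :=
  (u^T *m v) ord0 ord0.

Section DotProduct.
Variables (R : realType) (n : nat).
Implicit Types (u v w : 'cV[R]_n) (a : R).

Lemma dotE u v : dot u v = \sum_(i < n) u i ord0 * v i ord0.
Proof. by rewrite /dot mxE; apply: eq_bigr => i _; rewrite mxE. Qed.

Lemma dotC u v : dot u v = dot v u.
Proof. by rewrite !dotE; apply: eq_bigr => i _; rewrite mulrC. Qed.

Lemma dotDr u v w : dot u (v + w) = dot u v + dot u w.
Proof. by rewrite /dot mulmxDr mxE. Qed.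

Lemma dotDl u v w : dot (v + w) u = dot v u + dot w u.
Proof. by rewrite dotC dotDr !(dotC u). Qed.

Lemma dotZr a u v : dot u (a *: v) = a * dot u v.
Proof. by rewrite /dot -scalemxAr mxE. Qed.

Lemma dotZl a u v : dot (a *: v) u = a * dot v u.
Proof. by rewrite dotC dotZr dotC. Qed.

Lemma dotNr u v : dot u (- v) = - dot u v.
Proof. by rewrite -scaleN1r dotZr mulN1r. Qed.

Lemma dotNl u v : dot (- v) u = - dot v u.
Proof. by rewrite dotC dotNr dotC. Qed.

Lemma dot0r u : dot u 0 = 0.
Proof. by rewrite -(scale0r u) dotZr mul0r. Qed.

Lemma dot0l u : dot 0 u = 0.
Proof. by rewrite dotC dot0r. Qed.

Lemma dot_ge0 u : 0 <= dot u u.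
Proof. by rewrite dotE; apply: sumr_ge0 => i _; rewrite -expr2 sqr_ge0. Qed.

Lemma dot_eq0 u : (dot u u == 0) = (u == 0).
Proof.
apply/idP/eqP => [|->]; last by rewrite dot0r.
rewrite dotE psumr_eq0 => [/allP u0|i _]; last by rewrite -expr2 sqr_ge0.
apply/colP => i; rewrite mxE; apply/eqP.
by have := u0 i (mem_index_enum i); rewrite -expr2 sqrf_eq0.
Qed.

Lemma dot_gt0 u : (0 < dot u u) = (u != 0).
Proof. by rewrite lt_def dot_ge0 andbT dot_eq0. Qed.

Lemma enorm_sq u : enorm u ^+ 2 = dot u u.
Proof.
rewrite /enorm sqr_sqrtr ?dotE; first by apply: eq_bigr => i _; rewrite expr2.
by apply: sumr_ge0 => i _; rewrite sqr_ge0.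
Qed.

Lemma dot_parallelogram u v :
  dot (u + v) (u + v) + dot (u - v) (u - v) = 2 * (dot u u + dot v v).
Proof.
by rewrite !(dotDl, dotDr, dotNl, dotNr) (dotC v u); ring.
Qed.

Lemma dot_sqD_le u v : dot (u + v) (u + v) <= 2 * (dot u u + dot v v).
Proof. by rewrite -dot_parallelogram lerDl dot_ge0. Qed.

(** For [p = u - v] the coefficient [2 * dot p u / dot p p] of the reflection along [p] is therefore
    1, which is why that reflection sends [u] to [v]. *)
Lemma dot_sub_same_norm u v :
  dot u u = dot v v -> 2 * dot (u - v) u = dot (u - v) (u - v).
Proof.
by move=> uv; rewrite !(dotDl, dotDr, dotNl, dotNr) -uv (dotC v u); ring.
Qed.

End DotProduct.

Lemma dot_mulmxl (R : realType) (n m : nat) (M : 'M[R]_(n, m)) u v :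
  dot (M *m u) v = dot u (M^T *m v).
Proof. by rewrite /dot trmx_mul mulmxA. Qed.

Lemma enorm_le (R : realType) (n m : nat) (c : R) (u : 'cV[R]_n)
    (v : 'cV[R]_m) :
  0 <= c -> dot u u <= c ^+ 2 * dot v v -> enorm u <= c * enorm v.
Proof.
move=> c0 uv; rewrite -(@ler_pXn2r _ 2) ?nnegrE ?mulr_ge0 ?sqrtr_ge0 //.
by rewrite exprMn !enorm_sq.
Qed.

Lemma mulmx_colP (R : realType) (n m : nat) (M N : 'M[R]_(n, m)) :
  (forall z : 'cV_m, M *m z = N *m z) -> M = N.
Proof.
move=> MN; apply/matrixP => i j; move: (MN (delta_mx j ord0)).
by rewrite -!colE => /colP/(_ i); rewrite !mxE.
Qed.

(** * Orthogonal projections and Householder reflections *)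

Section OrthogonalExtension.
Variables (R : realType) (n : nat).
Implicit Types (u v w : 'cV[R]_n) (E : {vspace 'cV[R]_n}).

Lemma orthogonal_mxC (U : 'M[R]_n) : orthogonal_mx U -> U^T *m U = 1%:M.
Proof. exact: mulmx1C. Qed.

Lemma orthogonal_dot (U : 'M[R]_n) u :
  orthogonal_mx U -> dot (U *m u) (U *m u) = dot u u.
Proof. by move=> /orthogonal_mxC UU; rewrite dot_mulmxl mulmxA UU mul1mx. Qed.

Lemma orthogonal_tr (U : 'M[R]_n) : orthogonal_mx U -> orthogonal_mx U^T.
Proof. by rewrite /orthogonal_mx trmxK; apply: mulmx1C. Qed.

(** Gram-Schmidt along a spanning list: the new generator [a] is replaced by its part [p] orthogonal
    to the span of [s], and [v] is projected on [p] as well. *)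
Lemma orthogonal_decomposition E w :
  exists2 e, e \in E & forall z, z \in E -> dot (w - e) z = 0.
Proof.
suff span_dec (s : seq 'cV[R]_n) v :
    exists2 e, e \in span s & forall z, z \in span s -> dot (v - e) z = 0.
  have [e eE orth] := span_dec (vbasis E) w.
  by exists e => [|z]; rewrite -(span_basis (vbasisP E)) //; apply: orth.
elim: s v => [|a s IH] v.
  exists 0 => [|z]; rewrite span_nil ?mem0v // memv0 => /eqP ->.
  exact: dot0r.
have [a1 a1s a1P] := IH a; have [v1 v1s v1P] := IH v.
have sub z : z \in span s -> z \in span (a :: s).
  by move: z; apply/subvP; rewrite span_cons addvSr.
have a_in : a \in span (a :: s) by rewrite memv_span // inE eqxx.
exists (v1 + (dot v (a - a1) / dot (a - a1) (a - a1)) *: (a - a1)).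
  by apply: memvD; [exact: sub|apply/memvZ/memvB => //; exact: sub].
move=> z; rewrite span_cons => /memv_addP[_ /vlineP[c ->] [z1 z1s ->]].
have -> : c *: a + z1 = c *: (a - a1) + (c *: a1 + z1).
  by rewrite scalerBr addrA subrK.
set p := a - a1.
have pz : dot p (c *: a1 + z1) = 0 by rewrite a1P // rpredD ?rpredZ.
have vz : dot (v - v1) (c *: a1 + z1) = 0 by rewrite v1P // rpredD ?rpredZ.
have v1p : dot v1 p = 0 by rewrite dotC a1P.
set y := c *: a1 + z1 in pz vz *; set k := dot v p / dot p p.
have -> : dot (v - (v1 + k *: p)) (c *: p + y) =
    c * (dot v p - dot v1 p) + dot (v - v1) y - k * (c * dot p p + dot p y).
  by rewrite !(dotDl, dotDr, dotNl, dotNr, dotZl, dotZr); ring.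
(* The case [p = 0] occurs when [a] already lies in the span of [s]; every remaining term then
   vanishes. *)
rewrite vz pz v1p /k; have [->|p0] := eqVneq p 0.
  by rewrite !(dot0r, dot0l); ring.
by field; rewrite dot_eq0.
Qed.

(** The Householder reflection in the hyperplane orthogonal to [p]. *)
Definition reflection (p : 'cV[R]_n) : 'M[R]_n :=
  1%:M - (2 / dot p p) *: (p *m p^T).

Lemma reflectionE p z : reflection p *m z = z - (2 * dot p z / dot p p) *: p.
Proof.
rewrite mulmxBl mul1mx -scalemxAl -mulmxA [p^T *m z]mx11_scalar.
by rewrite mul_mx_scalar scalerA -/(dot p z) mulrAC.
Qed.

Lemma reflection_orthogonal p : p != 0 -> orthogonal_mx (reflection p).
Proof.
rewrite -dot_gt0 /orthogonal_mx => pp.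
have -> : (reflection p)^T = reflection p.
  by rewrite /reflection linearB linearZ /= trmx1 trmx_mul trmxK.
apply: mulmx_colP => z; rewrite mul1mx -mulmxA.
rewrite !reflectionE dotDr dotNr dotZr -addrA -opprD -scalerDl.
have -> : 2 * dot p z / dot p p +
    2 * (dot p z - 2 * dot p z / dot p p * dot p p) / dot p p = 0.
  by field; rewrite gt_eqF.
by rewrite scale0r subr0.
Qed.

(* A reflection swapping two vectors of the same length orthogonal to [E] brings
   [v] into the image of [E'] without touching [E]. *)
Lemma orthogonal_extension (W : 'M[R]_n) E (E' : {vspace 'cV[R]_n}) f v :
  orthogonal_mx W -> (E <= E')%VS -> f \in E' -> f \notin E ->
  exists W' : 'M[R]_n, [/\ orthogonal_mx W',
    forall z, z \in E -> W' *m z = W *m z &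
    exists2 e, e \in E' & v = W' *m e].
Proof.
move=> oW sE fE' fE; have [e eE we] := orthogonal_decomposition E (W^T *m v).
have [g gE fg] := orthogonal_decomposition E f.
have WWv : v = W *m (W^T *m v) by rewrite mulmxA oW mul1mx.
set r := W^T *m v - e in we; have [r0|rN0] := eqVneq r 0.
  exists W; split=> //; exists e; first exact: (subvP sE).
  by rewrite WWv; congr (_ *m _); apply/eqP; rewrite -subr_eq0 -/r r0.
have hN0 : f - g != 0.
  by apply: contraNneq fE => /eqP; rewrite subr_eq0 => /eqP ->.
(* The part [h] of [f] orthogonal to [E], rescaled to the length of [r], gives the vector [u] of
   [E'] that is to be exchanged with [r]. *)
set h := f - g in fg hN0; pose u := (enorm r / enorm h) *: h.
have hp : 0 < dot h h by rewrite dot_gt0.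
have ur : dot u u = dot r r.
  rewrite /u dotZl dotZr mulrA -expr2 exprMn exprVn !enorm_sq mulfVK //.
  by rewrite gt_eqF.
have uE' : u \in E' by apply/memvZ/memvB => //; exact: (subvP sE).
have uE z : z \in E -> dot u z = 0 by move=> zE; rewrite dotZl fg // mulr0.
have [urE|urN] := eqVneq u r.
  exists W; split=> //; exists (e + u).
    by apply: memvD => //; exact: (subvP sE).
  by rewrite urE /r addrC subrK.
set p := u - r; have pp : 0 < dot p p by rewrite dot_gt0 subr_eq0.
have pN0 : p != 0 by rewrite -dot_gt0.
have := reflection_orthogonal pN0; have := reflectionE p.
set P := reflection p => PE oP.
(* [P] fixes [E], to which [u] and [r] are orthogonal, and sends [u] to [r]; so [W *m P] sends
   [e + u] to [W *m (e + r)], which is [v]. *)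
exists (W *m P); split.
- by rewrite /orthogonal_mx trmx_mul mulmxA -(mulmxA W) oP mulmx1.
- move=> z zE; rewrite -mulmxA PE.
  by rewrite dotDl dotNl uE // we // subrr mulr0 mul0r scale0r subr0.
exists (e + u); first by apply: memvD => //; exact: (subvP sE).
have pu : 2 * dot p u = dot p p.
  exact: dot_sub_same_norm.
rewrite -mulmxA mulmxDr !PE pu divff ?gt_eqF // scale1r.
have -> : dot p e = 0 by rewrite dotDl dotNl uE // we // subrr.
rewrite mulr0 mul0r scale0r subr0 /p opprB [u + _]addrC subrK.
by rewrite /r addrC subrK.
Qed.

End OrthogonalExtension.

(** * The resisting oracle *)

Section Trajectory.
Variables (R : realType) (n m : nat) (A : algorithm R n m) (th : params R).
Variable z0 : 'cV[R]_n * 'cV[R]_m.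
Implicit Types (G : 'cV[R]_n -> 'cV[R]_m -> R).

Lemma mem_trajectory G k z :
  z \in trajectory A th G z0 k ->
  exists2 j, (j <= k)%N & z = iterate A th G z0 j.
Proof.
elim: k => [|k IH] /=; first by rewrite inE => /eqP ->; exists 0%N.
rewrite mem_rcons inE => /orP[/eqP ->|/IH[j jk ->]].
  by exists k.+1; rewrite // /iterate /= last_rcons.
by exists j => //; apply: leqW.
Qed.

Lemma trajectory_sub G j k :
  (j <= k)%N -> {subset trajectory A th G z0 j <= trajectory A th G z0 k}.
Proof.
elim: k => [|k IH]; first by rewrite leqn0 => /eqP ->.
rewrite leq_eqVlt => /orP[/eqP -> //|/IH sub z /sub zs] /=.
by rewrite mem_rcons inE zs orbT.
Qed.

Definition same_gradients G G' (s : seq ('cV[R]_n * 'cV[R]_m)) :=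
  forall z, z \in s -> gradx G' z.1 z.2 = gradx G z.1 z.2 /\
                       grady G' z.1 z.2 = grady G z.1 z.2.

Lemma same_gradients_history G G' s : same_gradients G G' s ->
  history_x G' s = history_x G s /\ history_y G' s = history_y G s.
Proof.
by move=> GG'; split; apply/eq_in_map => z /GG'[e1 e2]; rewrite ?e1 ?e2.
Qed.

(** An algorithm sees the objective only through gradients at points already visited, so agreement
    along the trajectory of [G] determines that of [G'] by induction. *)
Lemma same_gradients_trajectory G G' k :
  same_gradients G G' (trajectory A th G z0 k) ->
  forall j, (j <= k)%N -> trajectory A th G' z0 j = trajectory A th G z0 j.
Proof.
move=> GG'; elim=> [//|j IH] jk /=; rewrite IH ?(ltnW jk) //.
have [] := @same_gradients_history G G' (trajectory A th G z0 j).
  by move=> z zs; apply: GG'; apply: (trajectory_sub (ltnW jk)).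
by rewrite /step_x /step_y => -> ->.
Qed.

End Trajectory.

(** One step of an algorithm yields two targets, an iterate and an output. The second extension
    fixes [E j.+1], hence keeps the preimage found for [v1]. *)
Lemma orthogonal_extension2 (R : realType) (n : nat) (W : 'M[R]_n)
    (E : nat -> {vspace 'cV[R]_n}) (j : nat) (v1 v2 : 'cV[R]_n) :
  orthogonal_mx W -> (forall i, (E i <= E i.+1)%VS) ->
  (forall i, (j <= i <= j.+1)%N -> exists2 f, f \in E i.+1 & f \notin E i) ->
  exists W' : 'M[R]_n, [/\ orthogonal_mx W',
    forall z, z \in E j -> W' *m z = W *m z,
    exists2 e, e \in E j.+1 & W' *m e = v1 &
    exists2 e, e \in E j.+2 & W' *m e = v2].
Proof.
move=> oW sE str.
have [|f1 f1E f1N] := str j; first by rewrite leqnn leqnSn.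
have [W1 [oW1 W1E [e1 e1E v1E]]] := orthogonal_extension v1 oW (sE j) f1E f1N.
have [|f2 f2E f2N] := str j.+1; first by rewrite leqnn leqnSn.
have [W2 [oW2 W2E [e2 e2E v2E]]] :=
  orthogonal_extension v2 oW1 (sE j.+1) f2E f2N.
exists W2; split=> //; last by exists e2.
  by move=> z zE; rewrite W2E ?W1E // (subvP (sE j)).
by exists e1; rewrite // W2E.
Qed.

Lemma subv_chain_le (F : fieldType) (vT : vectType F) (E : nat -> {vspace vT}) :
  (forall j, (E j <= E j.+1)%VS) -> forall i j, (i <= j)%N -> (E i <= E j)%VS.
Proof.
move=> sE i; elim=> [|j IH]; first by rewrite leqn0 => /eqP ->.
rewrite leq_eqVlt => /orP[/eqP -> //|/IH h].
exact: subv_trans h (sE j).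
Qed.

Section ResistingOracle.
Variables (R : realType) (n m : nat) (A : algorithm R n m) (th : params R).
Variable G : 'M[R]_n -> 'M[R]_m -> 'cV[R]_n -> 'cV[R]_m -> R.
Variables (gx : 'cV[R]_n -> 'cV[R]_m -> 'cV[R]_n).
Variables (gy : 'cV[R]_n -> 'cV[R]_m -> 'cV[R]_m).
Variables (Ex : nat -> {vspace 'cV[R]_n}) (Ey : nat -> {vspace 'cV[R]_m}).
Variable K : nat.

Hypothesis gradxE : forall U V x y,
  gradx (G U V) x y = U^T *m gx (U *m x) (V *m y).
Hypothesis gradyE : forall U V x y,
  grady (G U V) x y = V^T *m gy (U *m x) (V *m y).
Hypothesis sEx : forall j, (Ex j <= Ex j.+1)%VS.
Hypothesis sEy : forall j, (Ey j <= Ey j.+1)%VS.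
Hypothesis gxE : forall j x y, x \in Ex j -> y \in Ey j -> gx x y \in Ex j.+1.
Hypothesis gyE : forall j x y, x \in Ex j -> y \in Ey j -> gy x y \in Ey j.+1.
Hypothesis strict_x : forall j, (0 < j <= 2 * K)%N ->
  exists2 f, f \in Ex j.+1 & f \notin Ex j.
Hypothesis strict_y : forall j, (0 < j <= 2 * K)%N ->
  exists2 f, f \in Ey j.+1 & f \notin Ey j.

Definition in_rotated U V j (z : 'cV[R]_n * 'cV[R]_m) : Prop :=
  (exists2 e, e \in Ex j & U^T *m e = z.1) /\
  (exists2 e, e \in Ey j & V^T *m e = z.2).

(* The rotation is revised at each step, but only off the subspace in which all
   previous gradients live, so that the past of the algorithm is unchanged while
   its next two points fall into the next two members of the chain. *)
Lemma resisting_oracle k : (k <= K)%N ->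
  exists U V, [/\ orthogonal_mx U, orthogonal_mx V,
    forall j, (j <= k)%N ->
      in_rotated U V (2 * j) (iterate A th (G U V) (0, 0) j) &
    forall j, (0 < j <= k)%N ->
      in_rotated U V (2 * j + 1) (output A th (G U V) (0, 0) j)].
Proof.
have lex := subv_chain_le sEx; have ley := subv_chain_le sEy.
elim: k => [_|k IHk kK].
  exists 1%:M, 1%:M; split.
  - by rewrite /orthogonal_mx trmx1 mulmx1.
  - by rewrite /orthogonal_mx trmx1 mulmx1.
  - move=> j; rewrite leqn0 => /eqP ->.
    by split; exists 0; rewrite ?mem0v ?mulmx0.
  - by case.
have [U [V [oU oV itP outP]]] := IHk (ltnW kK).
set s := trajectory A th (G U V) (0, 0) k.
have strict_lt i : (2 * k + 1 <= i <= (2 * k + 1).+1)%N -> (0 < i <= 2 * K)%N.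
  by move=> ?; lia.
(* Points lie in the images under [U^T], so [U^T] is what gets modified. It is kept on index
   [2 * k + 1], where the gradients at points of index [2 * k] live; the new iterate and output
   receive the two following indices. *)
have [W [oW WE W1 W2]] := orthogonal_extension2
  (step_x A th (G U V) k.+1 s).1 (step_x A th (G U V) k.+1 s).2
  (orthogonal_tr oU) sEx (fun i h => strict_x (strict_lt i h)).
have [Z [oZ ZE Z1 Z2]] := orthogonal_extension2
  (step_y A th (G U V) k.+1 s).1 (step_y A th (G U V) k.+1 s).2
  (orthogonal_tr oV) sEy (fun i h => strict_y (strict_lt i h)).
(* A past point has the same coordinates [e], [f] for both rotations, and [gx e f], [gy e f] lie
   where the old and new rotations agree. *)
have same : same_gradients (G U V) (G W^T Z^T) s.
  move=> z /mem_trajectory[j jk zE]; have [[e eE ez] [f fE fz]] := itP j jk.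
  rewrite -zE in ez fz; rewrite !gradxE !gradyE !trmxK -ez -fz.
  have eE' : e \in Ex (2 * k)%N by apply: (subvP (lex _ _ _)) eE; lia.
  have fE' : f \in Ey (2 * k)%N by apply: (subvP (ley _ _ _)) fE; lia.
  have Ue : U *m (U^T *m e) = e by rewrite mulmxA oU mul1mx.
  have Vf : V *m (V^T *m f) = f by rewrite mulmxA oV mul1mx.
  have We : W^T *m (U^T *m e) = e.
    rewrite -WE; first by rewrite mulmxA orthogonal_mxC ?mul1mx.
    by apply: (subvP (lex _ _ _)) eE'; lia.
  have Zf : Z^T *m (V^T *m f) = f.
    rewrite -ZE; first by rewrite mulmxA orthogonal_mxC ?mul1mx.
    by apply: (subvP (ley _ _ _)) fE'; lia.
  rewrite Ue Vf We Zf WE ?ZE //.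
    by rewrite addn1; apply: gyE.
  by rewrite addn1; apply: gxE.
have trE := same_gradients_trajectory same.
exists W^T, Z^T; split; try exact: orthogonal_tr.
  move=> j; rewrite leq_eqVlt => /orP[/eqP ->|].
    rewrite /iterate /= last_rcons trE // /step_x /step_y.
    have [-> ->] := same_gradients_history same.
    have -> : (2 * k.+1 = (2 * k + 1).+1)%N by lia.
    by split; rewrite trmxK.
  rewrite ltnS => jk; have [[e eE ez] [f fE fz]] := itP j jk.
  rewrite /iterate trE // -/(iterate _ _ _ _ _).
  split; rewrite trmxK; [exists e|exists f] => //.
    by rewrite WE //; apply: (subvP (lex _ _ _)) eE; lia.
  by rewrite ZE //; apply: (subvP (ley _ _ _)) fE; lia.
move=> j /andP[j0]; rewrite leq_eqVlt => /orP[/eqP ->|].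
  rewrite /output /= trE // /step_x /step_y.
  have [-> ->] := same_gradients_history same.
  have -> : (2 * k.+1 + 1 = (2 * k + 1).+2)%N by lia.
  by split; rewrite trmxK.
rewrite ltnS => jk; have [|[e eE ez] [f fE fz]] := outP j; first by rewrite j0.
(* The output of step [j] is computed from the iterates up to [j.-1], which the new rotation leaves
   in place. *)
have jk' : (j.-1 <= k)%N by lia.
rewrite /output trE // /step_x /step_y.
have [|-> ->] := @same_gradients_history _ _ _ (G U V) (G W^T Z^T)
  (trajectory A th (G U V) (0, 0) j.-1).
  by move=> z zs; apply: same; apply: (trajectory_sub jk').
split; rewrite trmxK; [exists e|exists f] => //.
  by rewrite WE //; apply: (subvP (lex _ _ _)) eE; lia.
by rewrite ZE //; apply: (subvP (ley _ _ _)) fE; lia.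
Qed.

End ResistingOracle.

(** * The Krylov subspaces *)

(* The junk value 0 beyond the last index spares the stencils their boundary
   cases. *)
Definition nth_entry (R : realType) (n : nat) (x : 'cV[R]_n) (j : nat) : R :=
  if insub j is Some i then x i ord0 else 0.

Section Entries.
Variables (R : realType) (n : nat).
Implicit Types x y : 'cV[R]_n.

Lemma nth_entryE x (i : 'I_n) : nth_entry x i = x i ord0.
Proof. by rewrite /nth_entry valK. Qed.

Lemma nth_entry_lt x j (jn : (j < n)%N) : nth_entry x j = x (Ordinal jn) ord0.
Proof. by rewrite -nth_entryE. Qed.

Lemma nth_entry_default x j : (n <= j)%N -> nth_entry x j = 0.
Proof. by move=> nj; rewrite /nth_entry insubF // ltnNge nj. Qed.

Lemma nth_entryD x y j : nth_entry (x + y) j = nth_entry x j + nth_entry y j.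
Proof. by rewrite /nth_entry; case: insub => [i|]; rewrite ?mxE ?addr0. Qed.

Lemma nth_entryZ a x j : nth_entry (a *: x) j = a * nth_entry x j.
Proof. by rewrite /nth_entry; case: insub => [i|]; rewrite ?mxE ?mulr0. Qed.

Lemma nth_entryN x j : nth_entry (- x) j = - nth_entry x j.
Proof. by rewrite -scaleN1r nth_entryZ mulN1r. Qed.

Lemma nth_entry0 j : nth_entry (0 : 'cV[R]_n) j = 0.
Proof. by rewrite -(scale0r 0) nth_entryZ mul0r. Qed.

Lemma nth_entryP x y :
  (forall j, (j < n)%N -> nth_entry x j = nth_entry y j) -> x = y.
Proof. by move=> xy; apply/colP => i; rewrite -!nth_entryE xy. Qed.

Lemma dot_nth x y :
  dot x y = \sum_(0 <= i < n) nth_entry x i * nth_entry y i.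
Proof.
by rewrite dotE big_mkord; apply: eq_bigr => i _; rewrite !nth_entryE.
Qed.

Lemma sum_nth_entry x k :
  \sum_(j < n) (if val j == k then x j ord0 else 0) = nth_entry x k.
Proof.
case: (ltnP k n) => [kn|nk]; last first.
  rewrite nth_entry_default // big1 // => j _.
  by case: eqP => // jk; have := ltn_ord j; rewrite jk ltnNge nk.
rewrite (nth_entry_lt _ kn) (bigD1 (Ordinal kn)) //= eqxx.
rewrite big1 ?addr0 // => j /eqP jN.
by case: eqP => // jk; case: jN; apply/val_inj.
Qed.

End Entries.

Lemma span_ind (F : fieldType) (vT : vectType F) (s : seq vT) (P : vT -> Prop) :
  P 0 -> (forall a x y, P x -> P y -> P (a *: x + y)) ->
  (forall x, x \in s -> P x) -> forall x, x \in span s -> P x.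
Proof.
move=> P0 PD; elim: s => [|a s IH] Ps x.
  by rewrite span_nil memv0 => /eqP ->.
rewrite span_cons => /memv_addP[_ /vlineP[c ->] [z zs ->]].
apply: PD; first by apply: Ps; rewrite inE eqxx.
by apply: IH zs => y ys; apply: Ps; rewrite inE ys orbT.
Qed.

(** * The antidiagonal matrix and its tridiagonal square *)

Section HardMatrix.
Variables (R : realType) (n : nat).
Implicit Types x y : 'cV[R]_n.
Local Notation A := (hard_A R n).

Lemma hard_A_sym : A^T = A.
Proof. by apply/matrixP => i j; rewrite !mxE addnC. Qed.

(** Row [j] has 1 in column [n - j.+1] and -1 in column [n - j]. For [j = 0] the latter column is
    out of range and [nth_entry] gives 0. *)
Lemma nth_hard_A x j : (j < n)%N ->
  nth_entry (A *m x) j = nth_entry x (n - j.+1) - nth_entry x (n - j).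
Proof.
move=> jn; rewrite (nth_entry_lt _ jn) mxE.
rewrite -2!sum_nth_entry -sumrB; apply: eq_bigr => i _; rewrite mxE /=.
have := ltn_ord i => iN.
have -> : ((j + i).+1 == n)%N = (val i == n - j.+1)%N.
  by apply/eqP/eqP => /=; lia.
have -> : (j + i == n)%N = (val i == n - j)%N by apply/eqP/eqP => /=; lia.
case: eqP => [->|_].
  have -> : (n - j.+1 == n - j)%N = false by apply/eqP; lia.
  by rewrite mul1r subr0.
by case: eqP => _; rewrite ?mulN1r ?mul0r sub0r ?oppr0.
Qed.

(** The square is the discrete Laplacian with stencil (-1, 2, -1), with a Neumann condition at the
    first entry and a Dirichlet condition beyond the last. *)
Lemma nth_hard_A2 x j : (j < n)%N ->
  nth_entry (A *m (A *m x)) j = nth_entry x j - nth_entry x j.+1 +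
    (if j is i.+1 then nth_entry x j - nth_entry x i else 0).
Proof.
move=> jn; rewrite nth_hard_A // nth_hard_A; last by lia.
have -> : (n - (n - j.+1).+1 = j)%N by lia.
have -> : (n - (n - j.+1) = j.+1)%N by lia.
case: j jn => [|j] jn.
  by rewrite subn0 (nth_entry_default (A *m x) (leqnn n)) subr0 addr0.
rewrite nth_hard_A; last by lia.
have -> : (n - (n - j.+1).+1 = j)%N by lia.
have -> : (n - (n - j.+1) = j.+1)%N by lia.
by rewrite opprB.
Qed.

Lemma dot_hard_A x y : dot (A *m x) y = dot x (A *m y).
Proof. by rewrite dot_mulmxl hard_A_sym. Qed.

(** In reversed order the entries of [A *m x] are the differences of consecutive entries of [x];
    each square is at most twice the sum of the two squares, and each entry of [x] occurs at most
    twice. *)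
Lemma dot_hard_A_le x : dot (A *m x) (A *m x) <= 4 * dot x x.
Proof.
rewrite dotE (reindex_inj rev_ord_inj) /=.
have same : dot x x = \sum_(i < n) nth_entry x i ^+ 2.
  by rewrite dot_nth big_mkord; apply: eq_bigr => i _; rewrite expr2.
have shift : \sum_(i < n) nth_entry x i.+1 ^+ 2 <= dot x x.
  rewrite same -(lerD2l (nth_entry x 0 ^+ 2)).
  rewrite -(big_ord_recl n (fun i => nth_entry x i ^+ 2)) /= big_ord_recr /=.
  by rewrite (nth_entry_default x (leqnn n)) expr0n addr0 lerDr sqr_ge0.
have := lerD (lexx (dot x x)) shift; rewrite {1}same -big_split /= => le2.
apply: (@le_trans _ _ (2 * \sum_(i < n)
    (nth_entry x i ^+ 2 + nth_entry x i.+1 ^+ 2))); last by lra.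
rewrite mulr_sumr; apply: ler_sum => i _.
rewrite -nth_entryE nth_hard_A /=; last by have := ltn_ord i; lia.
have -> : (n - (n - i.+1).+1 = i)%N by have := ltn_ord i; lia.
have -> : (n - (n - i.+1) = i.+1)%N by have := ltn_ord i; lia.
have := sqr_ge0 (nth_entry x i + nth_entry x i.+1); nra.
Qed.

(** Back substitution: a kernel vector vanishes entry by entry from the last one to the first. *)
Lemma hard_A_unit : A \in unitmx.
Proof.
rewrite unitmxE unitfE; apply/det0P => -[v vN0 vA]; case/eqP: vN0.
have Av : A *m v^T = 0 by rewrite -hard_A_sym -trmx_mul vA trmx0.
apply: trmx_inj; rewrite trmx0; apply: nth_entryP => j jn; rewrite nth_entry0.
suff all0 k : (k <= n)%N -> nth_entry v^T (n - k) = 0.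
  by rewrite -(all0 (n - j)%N); [congr nth_entry; lia|lia].
elim: k => [_|k IH kn]; first by rewrite subn0 nth_entry_default.
have := nth_hard_A v^T kn; rewrite Av nth_entry0 (IH (ltnW kn)) subr0.
by move=> <-.
Qed.

Lemma hard_A_exp2S i x :
  A ^+ (2 * i.+1) *m x = A *m (A *m (A ^+ (2 * i) *m x)).
Proof. by rewrite mulnS exprD expr2 /= !mulmxA. Qed.

Lemma hard_A_exp2C i x : A *m (A ^+ (2 * i) *m x) = A ^+ (2 * i) *m (A *m x).
Proof.
by rewrite !mulmxA; congr (_ *m x); rewrite mulmxE -exprS exprSr.
Qed.

End HardMatrix.

Section Krylov.
Variables (R : realType) (n : nat) (th : params R) (q : R).
Local Notation A := (hard_A R n).
Local Notation b := (hard_b n th q).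
Local Notation bhat := (hard_bhat n th q).
Local Notation c0 := (2 * Bx th * By th / Lxy th).

Definition gradFx (x y : 'cV[R]_n) : 'cV[R]_n :=
  Bx th *: (A *m (A *m x)) + mux th *: x + (Lxy th / 2) *: (A *m y).

Definition gradFy (x y : 'cV[R]_n) : 'cV[R]_n :=
  (Lxy th / 2) *: (A *m x) - (By th *: (A *m (A *m y)) + muy th *: y) - b.

Lemma hard_Ab : A *m b = c0 *: bhat.
Proof. by rewrite /hard_b -scalemxAr mulmxA mulmxV ?mul1mx ?hard_A_unit. Qed.

Lemma nth_hard_bhat j : (j < n)%N ->
  nth_entry bhat j =
    if j == 0%N then
      (2 + alpha th + beta th) * q - (3 + alpha th) * q ^+ 2 + q ^+ 3
    else if j == 1%N then q - 1 else 0.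
Proof. by move=> jn; rewrite (nth_entry_lt _ jn) mxE. Qed.

(** [bhat] lives on entries 0 and 1, and each application of the tridiagonal square extends the
    support by one entry. *)
Lemma krylov_support i l : (i.+1 < l)%N ->
  nth_entry (A ^+ (2 * i) *m bhat) l = 0.
Proof.
elim: i l => [|i IH] l il; have [ln|nl] := ltnP l n;
  try by rewrite nth_entry_default.
  by rewrite muln0 expr0 mul1mx nth_hard_bhat //; case: l il {ln} => [|[|]].
rewrite hard_A_exp2S nth_hard_A2 //; case: l il ln => // l il ln.
by rewrite !IH ?subrr ?addr0 //; lia.
Qed.

(** The front entry is multiplied by the off-diagonal -1 each time. It is nonzero for [q != 1],
    which makes the Krylov chains strictly increasing. *)
Lemma krylov_leading i : (i.+1 < n)%N ->
  nth_entry (A ^+ (2 * i) *m bhat) i.+1 = (- 1) ^+ i * (q - 1).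
Proof.
elim: i => [|i IH] ilt.
  by rewrite muln0 !expr0 mul1mx nth_hard_bhat // mul1r.
rewrite hard_A_exp2S nth_hard_A2 // (@krylov_support i i.+2) //.
rewrite (@krylov_support i i.+3); last by lia.
by rewrite IH ?(ltnW ilt) // exprS; ring.
Qed.

Lemma krylov_x_gen i j : (i < j.-1)%N ->
  A ^+ (2 * i) *m (A *m b) \in krylov_x n th q j.
Proof.
move=> ij; apply: memv_span.
by apply: (map_f (fun i => A ^+ (2 * i) *m (A *m b))); rewrite mem_iota.
Qed.

Lemma krylov_y_gen i j : (i < j)%N ->
  A ^+ (2 * i) *m b \in krylov_y n th q j.
Proof.
move=> ij; apply: memv_span.
by apply: (map_f (fun i => A ^+ (2 * i) *m b)); rewrite mem_iota.
Qed.

Lemma krylov_x_ind j (P : 'cV[R]_n -> Prop) :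
  P 0 -> (forall a x y, P x -> P y -> P (a *: x + y)) ->
  (forall i, (i < j.-1)%N -> P (A ^+ (2 * i) *m (A *m b))) ->
  forall x, x \in krylov_x n th q j -> P x.
Proof.
move=> P0 PD Pg; apply: span_ind => // x /mapP[i].
by rewrite mem_iota /= add0n => ij ->; apply: Pg.
Qed.

Lemma krylov_y_ind j (P : 'cV[R]_n -> Prop) :
  P 0 -> (forall a x y, P x -> P y -> P (a *: x + y)) ->
  (forall i, (i < j)%N -> P (A ^+ (2 * i) *m b)) ->
  forall x, x \in krylov_y n th q j -> P x.
Proof.
move=> P0 PD Pg; apply: span_ind => // x /mapP[i].
by rewrite mem_iota /= add0n => ij ->; apply: Pg.
Qed.

Lemma krylov_xS j : (krylov_x n th q j <= krylov_x n th q j.+1)%VS.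
Proof.
apply/subvP; apply: krylov_x_ind; first exact: mem0v.
  by move=> a x y xE yE; apply: memvD => //; apply: memvZ.
by move=> i ij; apply: krylov_x_gen; lia.
Qed.

Lemma krylov_yS j : (krylov_y n th q j <= krylov_y n th q j.+1)%VS.
Proof.
apply/subvP; apply: krylov_y_ind; first exact: mem0v.
  by move=> a x y xE yE; apply: memvD => //; apply: memvZ.
by move=> i ij; apply: krylov_y_gen; lia.
Qed.

Let memvPD (E : {vspace 'cV[R]_n}) (M : 'M[R]_n) a x y :
  M *m x \in E -> M *m y \in E -> M *m (a *: x + y) \in E.
Proof.
by move=> xE yE; rewrite mulmxDr -scalemxAr; apply: memvD => //; apply: memvZ.
Qed.

Lemma krylov_x_A2 j x : x \in krylov_x n th q j ->
  A *m (A *m x) \in krylov_x n th q j.+1.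
Proof.
rewrite mulmxA; apply: (@krylov_x_ind j (fun x => _ *m x \in _)).
- by rewrite mulmx0; exact: mem0v.
- by move=> a u v; apply: memvPD.
by move=> i ij; rewrite -mulmxA -hard_A_exp2S; apply: krylov_x_gen; lia.
Qed.

Lemma krylov_y_A2 j x : x \in krylov_y n th q j ->
  A *m (A *m x) \in krylov_y n th q j.+1.
Proof.
rewrite mulmxA; apply: (@krylov_y_ind j (fun x => _ *m x \in _)).
- by rewrite mulmx0; exact: mem0v.
- by move=> a u v; apply: memvPD.
by move=> i ij; rewrite -mulmxA -hard_A_exp2S; apply: krylov_y_gen; lia.
Qed.

Lemma krylov_x_A j x : x \in krylov_x n th q j ->
  A *m x \in krylov_y n th q j.+1.
Proof.
apply: (@krylov_x_ind j (fun x => _ *m x \in _)).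
- by rewrite mulmx0; exact: mem0v.
- by move=> a u v; apply: memvPD.
by move=> i ij; rewrite -hard_A_exp2C -hard_A_exp2S; apply: krylov_y_gen; lia.
Qed.

Lemma krylov_y_A j x : x \in krylov_y n th q j ->
  A *m x \in krylov_x n th q j.+1.
Proof.
apply: (@krylov_y_ind j (fun x => _ *m x \in _)).
- by rewrite mulmx0; exact: mem0v.
- by move=> a u v; apply: memvPD.
by move=> i ij; rewrite hard_A_exp2C krylov_x_gen.
Qed.

(** Together with [gradFy_krylov]: one gradient evaluation raises the Krylov index by one, as
    [resisting_oracle] requires. *)
Lemma gradFx_krylov j x y :
  x \in krylov_x n th q j -> y \in krylov_y n th q j ->
  gradFx x y \in krylov_x n th q j.+1.
Proof.
move=> xE yE; apply: memvD; last exact/memvZ/krylov_y_A.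
apply: memvD; first exact/memvZ/krylov_x_A2.
exact/memvZ/(subvP (krylov_xS j)).
Qed.

Lemma gradFy_krylov j x y :
  x \in krylov_x n th q j -> y \in krylov_y n th q j ->
  gradFy x y \in krylov_y n th q j.+1.
Proof.
move=> xE yE; apply: memvB; last first.
  by have := @krylov_y_gen 0 j.+1 isT; rewrite muln0 expr0 mul1mx.
apply: memvB; first exact/memvZ/krylov_x_A.
apply: memvD; first exact/memvZ/krylov_y_A2.
exact/memvZ/(subvP (krylov_yS j)).
Qed.

Lemma krylov_x_nth j x l : (j <= l)%N -> x \in krylov_x n th q j ->
  nth_entry x l = 0.
Proof.
move=> jl; move: x; apply: krylov_x_ind; first exact: nth_entry0.
  by move=> a x y x0 y0; rewrite nth_entryD nth_entryZ x0 y0 mulr0 addr0.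
move=> i ij; rewrite hard_Ab -scalemxAr nth_entryZ krylov_support ?mulr0 //.
by lia.
Qed.

Lemma krylov_x_strict j : c0 != 0 -> q != 1 -> (0 < j < n)%N ->
  exists2 f, f \in krylov_x n th q j.+1 & f \notin krylov_x n th q j.
Proof.
(* The last generator of index [j.+1] has a nonzero entry [j], where all members of index [j]
   vanish. *)
move=> c0N q1 /andP[j0 jn]; exists (A ^+ (2 * j.-1) *m (A *m b)).
  by apply: krylov_x_gen; lia.
apply/negP => /(krylov_x_nth (leqnn j)).
rewrite hard_Ab -scalemxAr nth_entryZ -{2}(prednK j0) krylov_leading ?prednK //.
apply/eqP/mulf_neq0 => //; apply: mulf_neq0; last by rewrite subr_eq0.
by rewrite signr_eq0.
Qed.

(* Multiplication by [A] sends [krylov_y j] into [krylov_x j.+1], which turns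
   strictness of one chain into strictness of the other. *)
Lemma krylov_y_strict j : c0 != 0 -> q != 1 -> (j.+1 < n)%N ->
  exists2 f, f \in krylov_y n th q j.+1 & f \notin krylov_y n th q j.
Proof.
move=> c0N q1 jn; exists (A ^+ (2 * j) *m b); first exact: krylov_y_gen.
apply/negP => /krylov_y_A /(krylov_x_nth (leqnn j.+1)).
rewrite hard_A_exp2C hard_Ab -scalemxAr nth_entryZ krylov_leading //.
apply/eqP/mulf_neq0 => //; apply: mulf_neq0; last by rewrite subr_eq0.
by rewrite signr_eq0.
Qed.

End Krylov.

(** * The problem class *)

Lemma bilin_dot (R : realType) (n m : nat) (M : 'M[R]_(n, m)) u v :
  bilin M u v = dot u (M *m v).
Proof. by rewrite /bilin /dot mulmxA. Qed.

Section Differentiability.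
Variables (R : realType) (n m : nat).
Local Notation Z := ('cV[R]_n * 'cV[R]_m)%type.
Implicit Types p : Z.

(** Entrywise, so that only sums and products of real-valued functions are differentiated. *)
Definition differentiable_entries k (f : Z -> 'cV[R]_k) p : Prop :=
  forall i, differentiable (fun z => f z i ord0 : R) p.

Lemma differentiable_entries_fst p : differentiable_entries fst p.
Proof.
move=> i; apply: (@differentiable_comp _ _ _ _ fst
  (fun x : 'cV[R]_n => x i ord0 : R)); last exact: differentiable_coord.
by apply: (@linear_differentiable _ _ _ (fst : {linear Z -> 'cV[R]_n})) => z;
  exact: cvg_fst.
Qed.

Lemma differentiable_entries_snd p : differentiable_entries snd p.
Proof.
move=> i; apply: (@differentiable_comp _ _ _ _ snd
  (fun x : 'cV[R]_m => x i ord0 : R)); last exact: differentiable_coord.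
by apply: (@linear_differentiable _ _ _ (snd : {linear Z -> 'cV[R]_m})) => z;
  exact: cvg_snd.
Qed.

Let differentiable_bigsum k (f : 'I_k -> Z -> R) p :
  (forall i, differentiable (f i) p) ->
  differentiable (fun z => \sum_(i < k) f i z) p.
Proof.
move=> df; rewrite (_ : (fun z => _) = \sum_(i < k) f i).
  exact: differentiable_sum.
by apply/funext => z; rewrite fct_sumE.
Qed.

Lemma differentiable_entries_mulmx k l (M : 'M[R]_(l, k)) f p :
  differentiable_entries f p -> differentiable_entries (fun z => M *m f z) p.
Proof.
move=> df i.
rewrite (_ : (fun z => _) = fun z => \sum_(j < k) M i j * f z j ord0).
  apply: differentiable_bigsum => j.
  by apply: (@differentiableM _ _ (cst (M i j)) (fun z => f z j ord0)).
by apply/funext => z; rewrite mxE.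
Qed.

Lemma differentiable_dot k (f g : Z -> 'cV[R]_k) p :
  differentiable_entries f p -> differentiable_entries g p ->
  differentiable (fun z => dot (f z) (g z)) p.
Proof.
move=> df dg.
rewrite (_ : (fun z => _) = fun z => \sum_(j < k) f z j ord0 * g z j ord0).
  by apply: differentiable_bigsum => j; apply: differentiableM.
by apply/funext => z; rewrite dotE.
Qed.

End Differentiability.

Lemma derive_quadratic (R : realType) (n : nat) (f : 'cV[R]_n -> R)
    (x v : 'cV[R]_n) (a c : R) :
  (forall h : R, f (x + h *: v) = f x + h * a + h ^+ 2 * c) ->
  derive f x v = a.
Proof.
move=> fE; rewrite /derive; apply: cvg_lim; first exact: norm_hausdorff.
have : (fun h : R => a + h * c) h @[h --> 0^'] --> a.
  have -> : nbhs a = nbhs (a + 0 * c) by rewrite mul0r addr0.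
  apply: cvg_within_filter; apply: cvgD; first exact: cvg_cst.
  by apply: cvgMl; exact: cvg_id.
apply: cvg_trans; apply: near_eq_cvg; near=> h.
have h0 : h != 0 by near: h; exact: nbhs_dnbhs_neq.
by rewrite /= [h *: v + x]addrC fE /GRing.scale /=; field.
Unshelve. all: by end_near.
Qed.

Lemma grad_quadratic (R : realType) (n : nat) (f : 'cV[R]_n -> R)
    (x g : 'cV[R]_n) (Q : 'cV[R]_n -> R) :
  (forall v (h : R), f (x + h *: v) = f x + h * dot g v + h ^+ 2 * Q v) ->
  grad f x = g.
Proof.
move=> fE; apply/colP => i; rewrite mxE (derive_quadratic (fE _)).
by rewrite /dot -colE !mxE.
Qed.

Lemma strongly_convex_quadratic (R : realType) (n : nat) (mu : R)
    (f : 'cV[R]_n -> R) (g : 'cV[R]_n -> 'cV[R]_n -> R) (Q : 'cV[R]_n -> R) :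
  (forall x v (h : R), f (x + h *: v) = f x + h * g x v + h ^+ 2 * Q v) ->
  (forall v, mu / 2 * dot v v <= Q v) -> strongly_convex mu f.
Proof.
move=> fE Qmu u v t /andP[t0 t1]; set w := t *: u + (1 - t) *: v.
(* Both points are displacements of [w] along [u - v], with steps [1 - t] and [- t]; weighted by [t]
   and [1 - t], the first-order terms cancel. *)
have uE : u = w + (1 - t) *: (u - v) by apply/colP => i; rewrite !mxE; ring.
have vE : v = w + (- t) *: (u - v) by apply/colP => i; rewrite !mxE; ring.
have fu := fE w (u - v) (1 - t); have fv := fE w (u - v) (- t).
rewrite -uE in fu; rewrite -vE in fv; rewrite enorm_sq fu fv.
have t1' : 0 <= 1 - t by rewrite subr_ge0.
have := ler_wpM2l (mulr_ge0 t0 t1') (Qmu (u - v)).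
set d := dot _ _; set e := Q _; nra.
Qed.

Lemma enormN (R : realType) (n : nat) (x : 'cV[R]_n) : enorm (- x) = enorm x.
Proof.
by rewrite /enorm; congr Num.sqrt; apply: eq_bigr => i _; rewrite mxE sqrrN.
Qed.

Section HardFunction.
Variables (R : realType) (n : nat) (th : params R) (q : R).
Local Notation A := (hard_A R n).
Local Notation b := (hard_b n th q).
Implicit Types x y u v : 'cV[R]_n.

Lemma hard_FE x y : hard_F th q x y =
  1 / 2 * (Bx th * dot (A *m x) (A *m x) + mux th * dot x x) +
  Lxy th / 2 * dot x (A *m y) -
  1 / 2 * (By th * dot (A *m y) (A *m y) + muy th * dot y y) - dot b y.
Proof.
rewrite /hard_F !bilin_dot -/(dot b y) !mulmxDl !mul_scalar_mx.
by rewrite -!scalemxAl expr2 -!mulmxA !(dotDr, dotZr) -!dot_hard_A.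
Qed.

(** A quadratic function equals its second-order expansion; gradients, strong convexity,
    stationarity at saddle points and growth around them are all read off from it. *)
Lemma hard_F_expand_x x y v h : hard_F th q (x + h *: v) y =
  hard_F th q x y + h * dot (gradFx th x y) v +
  h ^+ 2 * (1 / 2 * (Bx th * dot (A *m v) (A *m v) + mux th * dot v v)).
Proof.
rewrite !hard_FE /gradFx; move: b => c; rewrite mulmxDr -!scalemxAr.
rewrite !(dotDl, dotDr, dotZl, dotZr).
rewrite (dot_hard_A (A *m x) v) (dotC (A *m v) (A *m x)) (dotC v x).
by rewrite (dotC v (A *m y)); field.
Qed.

Lemma hard_F_expand_y x y v h : hard_F th q x (y + h *: v) =
  hard_F th q x y + h * dot (gradFy th q x y) v -
  h ^+ 2 * (1 / 2 * (By th * dot (A *m v) (A *m v) + muy th * dot v v)).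
Proof.
rewrite !hard_FE /gradFy; move: b => c; rewrite mulmxDr -!scalemxAr.
rewrite !(dotDl, dotDr, dotZl, dotZr, dotNl, dotNr).
rewrite (dot_hard_A (A *m y) v) (dotC (A *m v) (A *m y)) (dotC v y).
by rewrite (dot_hard_A x v); field.
Qed.

Variables U V : 'M[R]_n.
Local Notation G := (hard_FUV th q U V).

Lemma gradx_hard_FUV x y : gradx G x y = U^T *m gradFx th (U *m x) (V *m y).
Proof.
apply: grad_quadratic => v h; rewrite /hard_FUV mulmxDr -scalemxAr.
by rewrite hard_F_expand_x (dot_mulmxl U^T) trmxK.
Qed.

Lemma grady_hard_FUV x y : grady G x y = V^T *m gradFy th q (U *m x) (V *m y).
Proof.
apply: grad_quadratic => v h; rewrite /hard_FUV mulmxDr -scalemxAr.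
by rewrite hard_F_expand_y (dot_mulmxl V^T) trmxK -mulrN.
Qed.

Hypotheses (oU : orthogonal_mx U) (oV : orthogonal_mx V).

(** The norm of [A] is at most 2. With [c = Bx th] the bound [4 * c + mu] is exactly [Lx th], hence
    the 4 in [Bx] and [By]. *)
Let regularized_lip (c mu : R) (W : 'M[R]_n) (d : 'cV[R]_n) :
  orthogonal_mx W -> 0 <= c -> 0 <= mu ->
  enorm (W^T *m (c *: (A *m (A *m (W *m d))) + mu *: (W *m d))) <=
    (4 * c + mu) * enorm d.
Proof.
move=> oW c0 mu0; apply: enorm_le; first by lra.
rewrite orthogonal_dot; last exact: orthogonal_tr.
rewrite -(orthogonal_dot d oW); set w := W *m d.
set a := A *m w; set a2 := A *m a.
have -> : dot (c *: a2 + mu *: w) (c *: a2 + mu *: w) =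
    c * c * dot a2 a2 + 2 * (c * mu * dot a a) + mu * mu * dot w w.
  rewrite !(dotDl, dotDr, dotZl, dotZr) (dotC w a2).
  by rewrite (dot_hard_A a w) -/a; ring.
have h1 : dot a a <= 4 * dot w w := dot_hard_A_le w.
have h2 : dot a2 a2 <= 4 * dot a a := dot_hard_A_le a.
have h3 := ler_wpM2l (mulr_ge0 c0 c0) h2.
have h4 := ler_wpM2l (mulr_ge0 c0 c0) h1.
have h5 := ler_wpM2l (mulr_ge0 c0 mu0) h1.
by move: h3 h4 h5; lra.
Qed.

Let cross_lip (c : R) (W Z : 'M[R]_n) (d : 'cV[R]_n) :
  orthogonal_mx W -> orthogonal_mx Z -> 0 <= c ->
  enorm (W^T *m ((c / 2) *: (A *m (Z *m d)))) <= c * enorm d.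
Proof.
move=> oW oZ c0; apply: enorm_le => //.
rewrite orthogonal_dot; last exact: orthogonal_tr.
rewrite -(orthogonal_dot d oZ) dotZl dotZr.
have := ler_wpM2l (mulr_ge0 c0 c0) (dot_hard_A_le (Z *m d)); lra.
Qed.

Lemma hard_FUV_differentiable p :
  differentiable (fun z : 'cV[R]_n * 'cV[R]_n => G z.1 z.2) p.
Proof.
have dx := @differentiable_entries_fst R n n p.
have dy := @differentiable_entries_snd R n n p.
have dM := differentiable_entries_mulmx.
rewrite (_ : (fun z => _) = fun z =>
  1 / 2 * (Bx th * dot (A *m (U *m z.1)) (A *m (U *m z.1)) +
           mux th * dot (U *m z.1) (U *m z.1)) +
  Lxy th / 2 * dot (U *m z.1) (A *m (V *m z.2)) -
  1 / 2 * (By th * dot (A *m (V *m z.2)) (A *m (V *m z.2)) +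
           muy th * dot (V *m z.2) (V *m z.2)) - dot b (V *m z.2)); last first.
  by apply/funext => z; rewrite /hard_FUV hard_FE.
have dC (c : R) (f : 'cV[R]_n * 'cV[R]_n -> R) :
    differentiable f p -> differentiable (fun z => c * f z) p.
  by move=> df; apply: (@differentiableM _ _ (cst c) f).
have db : differentiable_entries (fun=> b) p.
  by move=> i; apply: differentiable_cst.
apply: differentiableB; last by apply: differentiable_dot; auto.
apply: differentiableB; last first.
  by apply/dC/differentiableD; apply/dC/differentiable_dot; auto.
apply: differentiableD; last by apply/dC/differentiable_dot; auto.
by apply/dC/differentiableD; apply/dC/differentiable_dot; auto.
Qed.

Hypothesis vth : valid_params th.

Lemma hard_FUV_class : problem_class th G.
Proof.
case: vth => mx my Lmx Lmy Lc.
have Bx0 : 0 <= Bx th by rewrite divr_ge0 //; lra.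
have By0 : 0 <= By th by rewrite divr_ge0 //; lra.
have LxE : 4 * Bx th + mux th = Lx th by rewrite /Bx; field.
have LyE : 4 * By th + muy th = Ly th by rewrite /By; field.
have mx0 := ltW mx; have my0 := ltW my; have Lc0 := ltW Lc.
split.
- exact: hard_FUV_differentiable.
- move=> y; apply: strongly_convex_quadratic => [x v h|v] /=.
    by rewrite /hard_FUV mulmxDr -scalemxAr hard_F_expand_x; reflexivity.
  have := mulr_ge0 Bx0 (dot_ge0 (A *m (U *m v))).
  by rewrite /= (orthogonal_dot v oU); lra.
- move=> x; apply: (@strongly_convex_quadratic _ _ _ _
      (fun y v => - dot (gradFy th q (U *m x) (V *m y)) (V *m v))
      (fun v => 1 / 2 * (By th * dot (A *m (V *m v)) (A *m (V *m v)) +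
                         muy th * dot (V *m v) (V *m v)))) => [y v h|v] /=.
    by rewrite /hard_FUV mulmxDr -scalemxAr hard_F_expand_y; ring.
  have := mulr_ge0 By0 (dot_ge0 (A *m (V *m v))).
  by rewrite /= (orthogonal_dot v oV); lra.
- move=> x1 x2 y; rewrite !gradx_hard_FUV -mulmxBr -LxE.
  have -> : gradFx th (U *m x1) (V *m y) - gradFx th (U *m x2) (V *m y) =
      Bx th *: (A *m (A *m (U *m (x1 - x2)))) + mux th *: (U *m (x1 - x2)).
    by rewrite /gradFx !mulmxBr; apply/colP => i; rewrite !mxE; ring.
  exact: regularized_lip.
- move=> x y1 y2; rewrite !grady_hard_FUV -mulmxBr -LyE.
  (* The quadratic part in [y] is negative, so the difference of gradients is the positive operator
     applied to [y2 - y1]. *)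
  rewrite -(enormN (y1 - y2)) (opprB y1).
  have -> : gradFy th q (U *m x) (V *m y1) - gradFy th q (U *m x) (V *m y2) =
      By th *: (A *m (A *m (V *m (y2 - y1)))) + muy th *: (V *m (y2 - y1)).
    by rewrite /gradFy !mulmxBr; apply/colP => i; rewrite !mxE; ring.
  exact: regularized_lip.
- move=> x y1 y2; rewrite !gradx_hard_FUV -mulmxBr.
  have -> : gradFx th (U *m x) (V *m y1) - gradFx th (U *m x) (V *m y2) =
      (Lxy th / 2) *: (A *m (V *m (y1 - y2))).
    by rewrite /gradFx !mulmxBr; apply/colP => i; rewrite !mxE; ring.
  exact: cross_lip.
- move=> x1 x2 y; rewrite !grady_hard_FUV -mulmxBr.
  have -> : gradFy th q (U *m x1) (V *m y) - gradFy th q (U *m x2) (V *m y) =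
      (Lxy th / 2) *: (A *m (U *m (x1 - x2))).
    by rewrite /gradFy !mulmxBr; apply/colP => i; rewrite !mxE; ring.
  exact: cross_lip.
Qed.

End HardFunction.

(** * The saddle point *)

Section Constants.
Variables (R : realType) (th : params R) (q : R).
Hypothesis vth : valid_params th.

Lemma Bx_gt0 : 0 < Bx th.
Proof. by case: vth => *; rewrite divr_gt0 //; lra. Qed.

Lemma By_gt0 : 0 < By th.
Proof. by case: vth => *; rewrite divr_gt0 //; lra. Qed.

Lemma alpha_gt0 : 0 < alpha th.
Proof.
have Bx0 := Bx_gt0; have By0 := By_gt0; case: vth => mx my _ _ Lc.
apply: addr_gt0; last exact: divr_gt0.
apply: addr_gt0; last exact: divr_gt0.
by rewrite divr_gt0 ?exprn_gt0 // mulr_gt0 // mulr_gt0.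
Qed.

Lemma beta_gt0 : 0 < beta th.
Proof.
have Bx0 := Bx_gt0; have By0 := By_gt0; case: vth => mx my _ _ _.
by apply: divr_gt0; apply: mulr_gt0.
Qed.

Lemma kappa_gt2 : 2 < kappa th.
Proof.
case: vth => mx my Lmx Lmy Lc.
have h1 : 1 < Lx th / mux th by rewrite ltr_pdivlMr // mul1r.
have h2 : 1 < Ly th / muy th by rewrite ltr_pdivlMr // mul1r.
have h3 : 0 < Lxy th ^+ 2 / (mux th * muy th).
  by rewrite divr_gt0 ?mulr_gt0 ?exprn_gt0.
by rewrite /kappa; lra.
Qed.

Hypothesis hq : hard_root th q.

(** Since [kappa th] exceeds 2, the term with the square roots is at least 1/2, so the inverse
    subtracted in the lower bound on [q] is at most 1. *)
Lemma hard_root_gt0 : 0 < q.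
Proof.
case: hq => _ lq _; apply: le_lt_trans lq.
have s2 : 0 < Num.sqrt (2 : R) by rewrite sqrtr_gt0.
have h : 1 / 2 <= 1 / (2 * Num.sqrt 2) * Num.sqrt (kappa th).
  have sk : Num.sqrt 2 <= Num.sqrt (kappa th).
    by have := kappa_gt2 => k2; rewrite ler_sqrt; lra.
  rewrite [leRHS]mulrAC [1 * Num.sqrt _]mul1r ler_pdivlMr ?mulr_gt0 //; lra.
by rewrite subr_ge0 invf_le1; lra.
Qed.

Lemma hard_root_lt1 : q < 1.
Proof.
case: hq => _ _ uq; apply: lt_le_trans uq _.
rewrite gerBl invr_ge0 addr_ge0 ?mulr_ge0 ?sqrtr_ge0 //; lra.
Qed.

End Constants.

(** * Optimality conditions and the eliminated linear system *)

Section HardSystem.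
Variables (R : realType) (n : nat) (th : params R) (q : R).
Local Notation A := (hard_A R n).
Local Notation b := (hard_b n th q).
Local Notation bhat := (hard_bhat n th q).
Local Notation c0 := (2 * Bx th * By th / Lxy th).
Hypotheses (vth : valid_params th).
Implicit Types x y u v : 'cV[R]_n.

(** First-order optimality: at [h = - a / (2 * k)] with [k] larger than the absolute value of [c],
    the linear term dominates and the value is negative unless [a = 0]. *)
Let perturbation_eq0 (a c : R) : (forall h, 0 <= h * a + h ^+ 2 * c) -> a = 0.
Proof.
move=> H; apply/eqP; rewrite -sqrf_eq0 eq_le sqr_ge0 andbT.
pose k := `|c| + 1; have k0 : 0 < k by rewrite ltr_wpDl.
have ck : c <= k by rewrite /k (le_trans (ler_norm c)) // lerDl.
have := H (- a / (2 * k)).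
have -> : - a / (2 * k) * a + (- a / (2 * k)) ^+ 2 * c =
    - (a ^+ 2 * (2 * k - c)) / (4 * k ^+ 2) by field; rewrite gt_eqF.
rewrite ler_pdivlMr ?mul0r ?mulr_gt0 ?exprn_gt0 // oppr_ge0.
by rewrite pmulr_lle0 //; lra.
Qed.

Lemma saddle_stationary xs ys : saddle_point (@hard_F R n th q) xs ys ->
  gradFx th xs ys = 0 /\ gradFy th q xs ys = 0.
Proof.
move=> sp; split; apply/eqP; rewrite -dot_eq0; apply/eqP.
  pose g := gradFx th xs ys.
  apply: (@perturbation_eq0 _
    (1 / 2 * (Bx th * dot (A *m g) (A *m g) + mux th * dot g g))).
  move=> h; have [_] := sp (xs + h *: g) ys.
  by rewrite hard_F_expand_x -addrA lerDl.
pose g := gradFy th q xs ys; apply/eqP; rewrite -oppr_eq0; apply/eqP.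
apply: (@perturbation_eq0 _
  (1 / 2 * (By th * dot (A *m g) (A *m g) + muy th * dot g g))).
move=> h; have [+ _] := sp xs (ys + h *: g).
by rewrite hard_F_expand_y -/g; lra.
Qed.

Lemma stationary_x_growth xs ys x : gradFx th xs ys = 0 ->
  hard_F th q xs ys + mux th / 2 * dot (x - xs) (x - xs) <= hard_F th q x ys.
Proof.
move=> g0; have := hard_F_expand_x th q xs ys (x - xs) 1.
rewrite scale1r addrC subrK g0 dot0l => ->.
have := mulr_ge0 (ltW (Bx_gt0 vth)) (dot_ge0 (A *m (x - xs))); lra.
Qed.

Lemma stationary_y_max xs ys y : gradFy th q xs ys = 0 ->
  hard_F th q xs y <= hard_F th q xs ys.
Proof.
move=> g0; have := hard_F_expand_y th q xs ys (y - ys) 1.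
rewrite scale1r addrC subrK g0 dot0l => ->.
have := mulr_ge0 (ltW (By_gt0 vth)) (dot_ge0 (A *m (y - ys))).
case: vth => _ my _ _ _; have := mulr_ge0 (ltW my) (dot_ge0 (y - ys)); lra.
Qed.

Definition hard_op x := A *m (A *m (A *m (A *m x))) +
  alpha th *: (A *m (A *m x)) + beta th *: x.

Lemma hard_opB x y : hard_op (x - y) = hard_op x - hard_op y.
Proof. by rewrite /hard_op !mulmxBr; apply/colP => i; rewrite !mxE; ring. Qed.

(** [A] is symmetric, so its second and fourth powers contribute squared norms. This gives both
    invertibility of [hard_op] and the error bound for [geom_vec]. *)
Lemma dot_hard_op x : beta th * dot x x <= dot x (hard_op x).
Proof.
have e4 : dot x (A *m (A *m (A *m (A *m x)))) =
    dot (A *m (A *m x)) (A *m (A *m x)) by rewrite -2!dot_hard_A.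
rewrite /hard_op !dotDr !dotZr e4 -(dot_hard_A x (A *m x)).
have := dot_ge0 (A *m (A *m x)).
by have := mulr_ge0 (ltW (alpha_gt0 vth)) (dot_ge0 (A *m x)); lra.
Qed.

(* Eliminating [y] from the optimality system. *)
Lemma stationary_hard_op xs ys :
  gradFx th xs ys = 0 -> gradFy th q xs ys = 0 -> hard_op xs = bhat.
Proof.
move=> gx gy; have Bx0 := Bx_gt0 vth; have By0 := By_gt0 vth.
case: vth => _ _ _ _ Lc.
have : A *m gradFy th q xs ys = 0 by rewrite gy mulmx0.
have : A *m (A *m gradFx th xs ys) = 0 by rewrite gx !mulmx0.
move: (hard_Ab n th q) gx; rewrite /gradFx /gradFy /hard_op; move: b => d Ad.
rewrite !(mulmxBr, mulmxDr) -!scalemxAr Ad.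
move: (A *m (A *m (A *m (A *m xs)))) => x4; move: (A *m (A *m xs)) => x2.
move: (A *m (A *m (A *m ys))) => y3; move: (A *m ys) bhat => y1 r.
move=> /colP e1 /colP e2 /colP e3; apply/colP => i.
move: (e1 i) (e2 i) (e3 i); rewrite !mxE => {}e1 {}e2 {}e3.
have [Bx0' By0' Lc0] : [/\ Bx th != 0, By th != 0 & Lxy th != 0].
  by rewrite !gt_eqF.
(* The equation in [x] and its image under the square of [A] express [A *m ys] and its image through
   [xs]; both are then substituted into [A] times the equation in [y]. *)
have y1E : y1 i ord0 =
    - (2 / Lxy th) * (Bx th * x2 i ord0 + mux th * xs i ord0).
  have -> : Bx th * x2 i ord0 + mux th * xs i ord0 = - (Lxy th / 2 * y1 i ord0).
    by lra.
  by field.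
have y3E : y3 i ord0 =
    - (2 / Lxy th) * (Bx th * x4 i ord0 + mux th * x2 i ord0).
  have -> : Bx th * x4 i ord0 + mux th * x2 i ord0 = - (Lxy th / 2 * y3 i ord0).
    by lra.
  by field.
have -> : r i ord0 = Lxy th / (2 * Bx th * By th) * (c0 * r i ord0).
  by field; rewrite Lc0 Bx0' By0'.
have -> : c0 * r i ord0 =
    Lxy th / 2 * x2 i ord0 - (By th * y3 i ord0 + muy th * y1 i ord0) by lra.
by rewrite y1E y3E /alpha /beta; field; rewrite Lc0 Bx0' By0'.
Qed.

Lemma hard_op_surj r : exists x, hard_op x = r.
Proof.
pose M : 'M[R]_n := A *m (A *m (A *m A)) + alpha th *: (A *m A) + (beta th)%:M.
have ME x : M *m x = hard_op x.
  by rewrite !mulmxDl -scalemxAl mul_scalar_mx -!mulmxA.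
have MT : M^T = M.
  rewrite /M !linearD linearZ /= tr_scalar_mx !trmx_mul !hard_A_sym.
  by rewrite !mulmxA.
have uM : M \in unitmx.
  rewrite unitmxE unitfE; apply/det0P => -[v vN0 vM]; case/eqP: vN0.
  have := dot_hard_op v^T; rewrite -ME -MT -trmx_mul vM trmx0 dot0r.
  rewrite pmulr_rle0 ?beta_gt0 // => v0; apply: trmx_inj; rewrite trmx0.
  by apply/eqP; rewrite -dot_eq0 eq_le v0 dot_ge0.
by exists (invmx M *m r); rewrite -ME mulmxA mulmxV // mul1mx.
Qed.

(** The elimination read backwards: [xs] solves the reduced system, [ys] comes from the first
    equation by inverting [A], and the second one is checked after multiplication by [A]. *)
Lemma stationary_exists :
  exists xs ys : 'cV[R]_n, gradFx th xs ys = 0 /\ gradFy th q xs ys = 0.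
Proof.
have Bx0 := Bx_gt0 vth; have By0 := By_gt0 vth.
have [Bx0' By0' Lc0] : [/\ Bx th != 0, By th != 0 & Lxy th != 0].
  by case: vth => *; rewrite !gt_eqF.
have [xs xsE] := hard_op_surj bhat.
have [ys Ays] : exists ys, A *m ys =
    - (2 / Lxy th) *: (Bx th *: (A *m (A *m xs)) + mux th *: xs).
  by eexists; apply: mulKVmx; apply: hard_A_unit.
exists xs, ys; split.
  by rewrite /gradFx Ays; apply/colP => i; rewrite !mxE; field.
suff : A *m gradFy th q xs ys = 0.
  move=> h; rewrite -[LHS]mul1mx -(mulVmx (hard_A_unit R n)) -mulmxA h.
  by rewrite mulmx0.
move: (hard_Ab n th q) xsE; rewrite /gradFy /hard_op; move: b => d Ad xsE.
rewrite !(mulmxBr, mulmxDr) -!scalemxAr Ad Ays -xsE.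
rewrite -!scalemxAr !mulmxDr -!scalemxAr.
move: (A *m (A *m (A *m (A *m xs)))) => x4; move: (A *m (A *m xs)) => x2.
apply/colP => i; rewrite !mxE /alpha /beta.
by field; rewrite Lc0 Bx0' By0'.
Qed.

End HardSystem.

(** * Approximation of the solution by a geometric sequence *)

Section GeometricApproximation.
Variables (R : realType) (n : nat) (th : params R) (q : R).
Hypotheses (vth : valid_params th) (hq : hard_root th q) (n5 : (4 < n)%N).
Local Notation A := (hard_A R n).
Local Notation bhat := (hard_bhat n th q).

Definition geom_vec : 'cV[R]_n := \col_(i < n) q ^+ i.+1.

Lemma nth_geom j : (j < n)%N -> nth_entry geom_vec j = q ^+ j.+1.
Proof. by move=> jn; rewrite (nth_entry_lt _ jn) mxE. Qed.

Lemma nth_geom_ge j : (n <= j)%N -> nth_entry geom_vec j = 0.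
Proof. exact: nth_entry_default. Qed.

Lemma nth_hard_op x j : nth_entry (hard_op th x) j =
  nth_entry (A *m (A *m (A *m (A *m x)))) j +
  alpha th * nth_entry (A *m (A *m x)) j + beta th * nth_entry x j.
Proof. by rewrite /hard_op !nth_entryD !nth_entryZ. Qed.

Let residual := bhat - hard_op th geom_vec.

Let nth_residual j : nth_entry residual j =
  nth_entry bhat j - (nth_entry (A *m (A *m (A *m (A *m geom_vec)))) j +
    alpha th * nth_entry (A *m (A *m geom_vec)) j +
    beta th * nth_entry geom_vec j).
Proof. by rewrite nth_entryD nth_entryN nth_hard_op. Qed.

Let root : 1 - (4 + alpha th) * q + (6 + 2 * alpha th + beta th) * q ^+ 2 -
  (4 + alpha th) * q ^+ 3 + q ^+ 4 = 0.
Proof. by case: hq. Qed.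

Let root_mul (c x : R) : x = c * (1 - (4 + alpha th) * q +
    (6 + 2 * alpha th + beta th) * q ^+ 2 - (4 + alpha th) * q ^+ 3 + q ^+ 4) ->
  x = 0.
Proof. by rewrite root mulr0. Qed.

(** The first entry of [bhat] makes row 0 hold identically; every other row here is a multiple of
    the root equation, with the cofactor passed to [root_mul]. *)
Lemma nth_residual_eq0 j : (j.+2 < n)%N -> nth_entry residual j = 0.
Proof.
move=> jn; rewrite nth_residual nth_hard_bhat; last by lia.
case: j jn => [|[|j]] jn /=.
- do !(rewrite nth_hard_A2 /=; last by lia).
  by do !(rewrite nth_geom; last by lia); ring.
- do !(rewrite nth_hard_A2 /=; last by lia).
  do !(rewrite nth_geom; last by lia).
  by apply: (@root_mul (- 1)); ring.
do !(rewrite nth_hard_A2 /=; last by lia).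
do !(rewrite nth_geom; last by lia).
by apply: (@root_mul (- q ^+ j.+1)); rewrite !exprS; ring.
Qed.

(* Entries [n] and [n + 1] of the geometric sequence are cut off, which leaves a
   defect in the last two equations only. *)
Lemma nth_residual_penultimate m : n = m.+4 ->
  nth_entry residual m.+2 = q ^+ n * q.
Proof.
move=> nE; rewrite nth_residual nth_hard_bhat /=; last by lia.
do !(rewrite nth_hard_A2 /=; last by lia).
rewrite (@nth_geom_ge m.+4); last by lia.
do !(rewrite nth_geom; last by lia).
apply/eqP; rewrite -subr_eq0; apply/eqP; rewrite nE.
by apply: (@root_mul (- q ^+ m.+1)); rewrite !exprS; ring.
Qed.

Lemma nth_residual_last m : n = m.+4 ->
  nth_entry residual m.+3 = q ^+ n * (1 - (4 + alpha th) * q + q ^+ 2).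
Proof.
move=> nE; rewrite nth_residual nth_hard_bhat /=; last by lia.
rewrite nth_hard_A2 /=; last by lia.
(* In the last row the intermediate vector is cut off too, which accounts for the different
   defect. *)
rewrite (@nth_entry_default _ _ (A *m (A *m geom_vec)) m.+4); last by lia.
do !(rewrite nth_hard_A2 /=; last by lia).
rewrite (@nth_geom_ge m.+4); last by lia.
do !(rewrite nth_geom; last by lia).
apply/eqP; rewrite -subr_eq0; apply/eqP; rewrite nE.
by apply: (@root_mul (- q ^+ m.+2)); rewrite !exprS; ring.
Qed.

(** The two summands bound the squared defects of the last two rows, divided by [q ^+ (2 * n)]. *)
Definition residual_const : R := 1 + (6 + alpha th) ^+ 2.

Lemma residual_le : dot residual residual <= residual_const * q ^+ (2 * n).
Proof.
have [m nE] : exists m, n = m.+4 by exists (n - 4)%N; lia.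
have q0 := hard_root_gt0 vth hq; have q1 := hard_root_lt1 hq.
have sum_last (F : nat -> R) : (forall i, (i < m.+2)%N -> F i = 0) ->
    \sum_(0 <= i < m.+4) F i = F m.+2 + F m.+3.
  move=> F0; do 2!rewrite big_nat_recr //=.
  by rewrite big_nat big1 ?add0r // => i /F0.
have -> : dot residual residual = (q ^+ n * q) ^+ 2 +
    (q ^+ n * (1 - (4 + alpha th) * q + q ^+ 2)) ^+ 2.
  rewrite dot_nth -(nth_residual_penultimate nE) -(nth_residual_last nE) {1}nE.
  rewrite sum_last ?expr2 // => i im; rewrite nth_residual_eq0 ?mul0r //; lia.
have a0 := alpha_gt0 vth; rewrite mulnC exprM !exprMn -mulrDr mulrC.
apply: ler_wpM2r; first by rewrite sqr_ge0.
apply: lerD; first by rewrite expr_le1 // ltW.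
have qq : q ^+ 2 <= 1 by rewrite expr_le1 // ltW.
have q2 := sqr_ge0 q.
have aq : 0 <= (4 + alpha th) * q <= 4 + alpha th.
  by rewrite mulr_ge0 /= ?ler_piMr ?ltW //; lra.
set c := 1 - _ + _; set K := 6 + _.
have K1 : 0 <= K - c by rewrite /K /c; lra.
have K2 : 0 <= K + c by rewrite /K /c; lra.
by have := mulr_ge0 K1 K2; lra.
Qed.

(* [hard_op] is bounded below by [beta], so a small residual means a small
   error. *)
Lemma geom_vec_error xs : hard_op th xs = bhat ->
  dot (xs - geom_vec) (xs - geom_vec) <=
    residual_const / beta th ^+ 2 * q ^+ (2 * n).
Proof.
move=> xsE; have b0 := beta_gt0 vth.
have rE : hard_op th (xs - geom_vec) = residual by rewrite hard_opB xsE.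
have := dot_hard_op vth (xs - geom_vec); have := residual_le; rewrite rE.
move: (residual) (xs - geom_vec) => r e rl eb.
(* This square stands in for the Cauchy-Schwarz inequality between [r] and [e]. *)
have := dot_ge0 (r - beta th *: e).
rewrite !(dotDl, dotDr, dotNl, dotNr, dotZl, dotZr) (dotC r e) => rb.
rewrite mulrAC ler_pdivlMr ?exprn_gt0 //.
by have := ler_wpM2l (ltW b0) eb; lra.
Qed.

End GeometricApproximation.

(** * Partial sums of squares of the geometric sequence *)

Section GeometricSums.
Variables (R : realType) (q : R).

Definition geometric_sum m : R := \sum_(0 <= i < m) (q ^+ i.+1) ^+ 2.

Lemma geometric_sum_nneg m : 0 <= geometric_sum m.
Proof. by apply: sumr_ge0 => i _; rewrite sqr_ge0. Qed.

Lemma geometric_sum_split p n : (p <= n)%N -> geometric_sum n =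
  geometric_sum p + q ^+ (2 * p) * geometric_sum (n - p).
Proof.
move=> pn; rewrite /geometric_sum (big_cat_nat (leq0n p) pn) /=; congr (_ + _).
rewrite -{1}[p]add0n big_addn mulr_sumr; apply: eq_bigr => i _.
rewrite (_ : (i + p).+1 = (p + i.+1)%N); last by lia.
by rewrite exprD exprMn (mulnC 2%N p) exprM.
Qed.

Hypotheses (q0 : 0 < q) (q1 : q < 1).

Lemma geometric_small (E e : R) : 0 < e ->
  exists N : nat, forall n, (N <= n)%N -> E * q ^+ (2 * n) <= e.
Proof.
move=> e0; have k0 : 0 < `|E| + 1 by rewrite ltr_wpDl.
have qn : q ^+ n @[n --> \oo] --> (0 : R) by apply: cvg_expr; rewrite gtr0_norm.
have /cvgrPdist_le/(_ _ (divr_gt0 e0 k0))[N _ NP] := qn.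
exists N => n Nn; have := NP n Nn; rewrite /= sub0r normrN normrX gtr0_norm //.
rewrite ler_pdivlMr // => qe; have qn0 : 0 < q ^+ n by rewrite exprn_gt0.
have qq : (q ^+ n) ^+ 2 <= q ^+ n.
  by rewrite expr2; apply: ler_piMl; [exact: ltW|rewrite exprn_ile1 ?ltW].
have l1 := ler_wpM2r (sqr_ge0 (q ^+ n)) (ler_norm E).
by have l2 := ler_wpM2l (normr_ge0 E) qq; rewrite mulnC exprM; lra.
Qed.

(** The last [p] terms are dominated by the first [p], which are among the first [n - p] when
    [2 * p <= n]. *)
Lemma geometric_sum_le p n : (2 * p <= n)%N ->
  geometric_sum n <= 2 * geometric_sum (n - p).
Proof.
move=> pn; rewrite (@geometric_sum_split (n - p)); last by lia.
have -> : (n - (n - p) = p)%N by lia.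
have le1 : q ^+ (2 * (n - p)) * geometric_sum p <= geometric_sum p.
  by rewrite ler_piMl ?geometric_sum_nneg // exprn_ile1 // ltW.
have le2 : geometric_sum p <= geometric_sum (n - p).
  rewrite (@geometric_sum_split p (n - p)); last by lia.
  by rewrite lerDl mulr_ge0 ?geometric_sum_nneg // exprn_ge0 // ltW.
by lra.
Qed.

Lemma geometric_sum_ge n : (0 < n)%N -> q ^+ 2 <= geometric_sum n.
Proof.
case: n => // n _; rewrite (@geometric_sum_split 1) //.
rewrite {1}/geometric_sum big_nat1 expr1 lerDl.
by rewrite mulr_ge0 ?geometric_sum_nneg // exprn_ge0 // ltW.
Qed.

End GeometricSums.

Section TailEstimate.
Variables (R : realType) (n : nat) (q : R).
Hypotheses (q0 : 0 < q) (q1 : q < 1).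
Implicit Types u xs : 'cV[R]_n.
Local Notation geom := (geom_vec n q).

Lemma dot_tail_le p u xs : (forall i, (p <= i)%N -> nth_entry u i = 0) ->
  \sum_(p <= i < n) nth_entry xs i ^+ 2 <= dot (u - xs) (u - xs).
Proof.
move=> u0; have [np|pn] := leqP n p; first by rewrite big_geq // dot_ge0.
rewrite dot_nth (big_cat_nat (leq0n p) (ltnW pn)) /= -[leLHS]add0r lerD //.
  by apply: sumr_ge0 => i _; rewrite -expr2 sqr_ge0.
rewrite [leLHS]big_nat [leRHS]big_nat; apply: ler_sum => i /andP[pi _].
by rewrite nth_entryD nth_entryN u0 // sub0r -expr2 sqrrN.
Qed.

Lemma dot_nth_le u i : nth_entry u i ^+ 2 <= dot u u.
Proof.
have [ni|iN] := leqP n i.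
  by rewrite nth_entry_default // expr0n dot_ge0.
have := @dot_tail_le i 0 u (fun j _ => nth_entry0 _ _ j).
rewrite sub0r dotNl dotNr opprK; apply: le_trans.
rewrite big_ltn // lerDl; apply: sumr_ge0 => j _; exact: sqr_ge0.
Qed.

(** With [Q = q ^+ (2 * p)] and [S = dot geom geom], the tail of [geom] is at least [Q * S / 2], so
    that of [xs] is at least [Q * S / 4 - d], while [dot xs xs] is at most [2 * (S + d)]. As
    [d <= Q * S / 16], the factor 1/16 suffices. *)
Lemma tail_estimate p u xs : (0 < n)%N -> (2 * p <= n)%N ->
  (forall i, (p <= i)%N -> nth_entry u i = 0) ->
  dot (xs - geom) (xs - geom) <= q ^+ (2 * p) * (q ^+ 2 / 16) ->
  q ^+ (2 * p) / 16 * dot xs xs <= dot (u - xs) (u - xs).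
Proof.
move=> n0 pn u0; set d := dot (xs - geom) _ => dle.
have := dot_tail_le xs u0; set T := \sum_(p <= i < n) _ => Tle.
have gg : dot geom geom = geometric_sum q n.
  rewrite dot_nth; apply: eq_big_nat => i /= iN.
  by rewrite nth_geom // expr2.
have gtail : \sum_(p <= i < n) nth_entry geom i ^+ 2 =
    q ^+ (2 * p) * geometric_sum q (n - p).
  apply: (addrI (geometric_sum q p)); rewrite -geometric_sum_split; last by lia.
  have pn' : (p <= n)%N by lia.
  rewrite -gg dot_nth (big_cat_nat (leq0n p) pn') /=.
  congr (_ + _).
  apply: eq_big_nat => i /= iN.
  by rewrite nth_geom; [rewrite expr2|lia].
have T2 : \sum_(p <= i < n) nth_entry geom i ^+ 2 <= 2 * (T + d).
  apply: (@le_trans _ _ (2 * (T +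
      \sum_(p <= i < n) nth_entry (xs - geom) i ^+ 2))).
    rewrite -big_split /= mulr_sumr; apply: ler_sum => i _.
    rewrite nth_entryD nth_entryN.
    move: (nth_entry geom i) (nth_entry xs i) => a c.
    have := sqr_ge0 (2 * c - a); lra.
  rewrite ler_pM2l // lerD2l.
  have := @dot_tail_le p 0 (xs - geom) (fun j _ => nth_entry0 _ _ j).
  by rewrite sub0r dotNl dotNr opprK.
have xs2 : dot xs xs <= 2 * (dot geom geom + d).
  by have := dot_sqD_le geom (xs - geom); rewrite addrC subrK.
have Q0 : 0 < q ^+ (2 * p) by rewrite exprn_gt0.
have Q1 : q ^+ (2 * p) <= 1 by rewrite exprn_ile1 // ltW.
rewrite gtail in T2.
have Sle := ler_wpM2l (ltW Q0) (geometric_sum_le q0 q1 pn).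
have Sge := ler_wpM2l (ltW Q0) (geometric_sum_ge q0 n0).
rewrite gg in xs2.
have := ler_wpM2l (ltW Q0) xs2.
have d0 : 0 <= d by apply: dot_ge0.
have := ler_wpM2r d0 Q1.
lra.
Qed.

End TailEstimate.

(** * Lower bounds *)

Section Assembly.
Variables (R : realType) (n : nat) (th : params R) (q : R).
Hypotheses (vth : valid_params th) (hq : hard_root th q).

(** The dimension bound is what strictness of the [krylov_y] chain at index [2 * K] demands. *)
Lemma hard_oracle (K : nat) (alg : algorithm R n n) : (2 * K + 1 < n)%N ->
  exists U V : 'M[R]_n,
    let G := hard_FUV th q U V in
    [/\ orthogonal_mx U, orthogonal_mx V, problem_class th G,
      forall j, (j <= K)%N ->
        rotated_krylov th q U V (2 * j) (iterate alg th G (0, 0) j) &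
      forall j, (0 < j <= K)%N ->
        rotated_krylov th q U V (2 * j + 1) (output alg th G (0, 0) j)].
Proof.
move=> Kn; have c0 : 2 * Bx th * By th / Lxy th != 0.
  have Bx0 := Bx_gt0 vth; have By0 := By_gt0 vth; case: vth => *.
  by rewrite gt_eqF // divr_gt0 // mulr_gt0 // mulr_gt0.
have q1 : q != 1 by rewrite lt_eqF // (hard_root_lt1 hq).
have sx j : (0 < j <= 2 * K)%N ->
    exists2 f, f \in krylov_x n th q j.+1 & f \notin krylov_x n th q j.
  by move=> jK; apply: krylov_x_strict => //; lia.
have sy j : (0 < j <= 2 * K)%N ->
    exists2 f, f \in krylov_y n th q j.+1 & f \notin krylov_y n th q j.
  by move=> jK; apply: krylov_y_strict => //; lia.
have [U [V [oU oV itP outP]]] := @resisting_oracle R n n alg th _ _ _ _ _ K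
  (gradx_hard_FUV th q) (grady_hard_FUV th q) (krylov_xS n th q)
  (krylov_yS n th q) (@gradFx_krylov R n th q) (@gradFy_krylov R n th q)
  sx sy K (leqnn K).
exists U, V; split=> //; exact: hard_FUV_class.
Qed.

Lemma rotated_krylov_le U V i j z : (i <= j)%N ->
  rotated_krylov th q U V i z -> @rotated_krylov R n th q U V j z.
Proof.
move=> ij [[u uE uz] [v vE vz]].
split; [exists u|exists v] => //.
  exact: (subvP (subv_chain_le (krylov_xS n th q) ij)) uE.
exact: (subvP (subv_chain_le (krylov_yS n th q) ij)) vE.
Qed.

(** The supremum is tested at the rotated [ys] and the infimum at the rotated [xs]; strong convexity
    in [x] provides the quadratic term. *)
Lemma duality_gap_ge U V xs ys (z : 'cV[R]_n * 'cV[R]_n) :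
  orthogonal_mx U -> orthogonal_mx V ->
  gradFx th xs ys = 0 -> gradFy th q xs ys = 0 ->
  ((mux th / 2 * dot (U *m z.1 - xs) (U *m z.1 - xs))%:E <=
    duality_gap (hard_FUV th q U V) z)%E.
Proof.
move=> oU oV gx gy; set d := dot _ _.
apply: (@le_trans _ _ ((hard_FUV th q U V z.1 (V^T *m ys))%:E -
  (hard_FUV th q U V (U^T *m xs) z.2)%:E)%E).
  rewrite -EFinB lee_fin /hard_FUV !mulmxA oU oV !mul1mx.
  have := stationary_x_growth q vth (U *m z.1) gx.
  have := stationary_y_max vth (V *m z.2) gy.
  by rewrite -/d; lra.
apply: leeB; first by apply: ereal_sup_ubound; exists (V^T *m ys).
by apply: ereal_inf_lbound; exists (U^T *m xs).
Qed.

End Assembly.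

Lemma half_sq_le (R : realType) (a g : R) : 0 <= g ->
  (a - g) ^+ 2 <= g ^+ 2 / 4 -> g ^+ 2 / 4 <= a ^+ 2.
Proof.
move=> g0 ag; have : g / 2 <= a.
  rewrite leNgt; apply/negP => ag2.
  have : (g / 2) * (g / 2) < (g - a) * (g - a) by apply: ltr_pM; lra.
  by lra.
move=> ga; have : (g / 2) * (g / 2) <= a * a by apply: ler_pM; lra.
by lra.
Qed.

(* [ln (1 / q) <= 1 / q - 1], and the lower bound on the root makes the right
   side [O (1 / sqrt kappa)] as long as [kappa] stays away from 2. *)
Lemma ln_hard_root (R : realType) (kappa0 : R) : 2 < kappa0 ->
  exists M : R, 0 < M /\ forall (th : params R) (q : R),
    valid_params th -> hard_root th q -> kappa0 <= kappa th ->
    - ln q * Num.sqrt (kappa th) <= M.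
Proof.
move=> k0; have s2 : 0 < Num.sqrt (2 : R) by rewrite sqrtr_gt0.
pose S (k : R) := 1 / (2 * Num.sqrt 2) * Num.sqrt k.
have Smono (a b : R) : 0 < b -> a <= b -> S a <= S b.
  move=> b0 ab; apply: ler_wpM2l; last by rewrite ler_sqrt // ltW.
  by rewrite divr_ge0 // mulr_ge0 // ltW.
have S0 : 1 / 2 < S kappa0.
  have : Num.sqrt 2 < Num.sqrt kappa0 by rewrite ltr_sqrt //; lra.
  move=> h; rewrite /S [ltRHS]mulrAC [1 * Num.sqrt _]mul1r.
  by rewrite ltr_pdivlMr ?mulr_gt0 //; lra.
(* For every [s >= s0] this choice gives [r * s <= s - 1 / 2], and [r] is positive because [s0]
   exceeds 1/2. *)
set s0 := S kappa0 in S0; pose r := 1 - 1 / (2 * s0).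
have s0p : 0 < s0 by lra.
have r0 : 0 < r by rewrite subr_gt0 ltr_pdivrMr; lra.
exists (2 * Num.sqrt 2 / r); split; first by rewrite divr_gt0 // mulr_gt0.
move=> th q vth hq kk; have q0 := hard_root_gt0 vth hq.
have [_ + _] := hq; rewrite -/(S (kappa th)); set s := S (kappa th) => lq.
have s0s : s0 <= s by apply: Smono => //; have := kappa_gt2 vth; lra.
have sk : Num.sqrt (kappa th) = 2 * Num.sqrt 2 * s.
  by rewrite /s /S; field; rewrite gt_eqF.
have lnq : - ln q <= 1 / q - 1.
  have h : - 1 < 1 / q - 1 by have : 0 < 1 / q by [rewrite divr_gt0]; lra.
  by have := le_ln1Dx h; rewrite (addrC 1) subrK {1}div1r lnV ?posrE.
have rs : r * s <= s - 1 / 2.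
  have : 1 <= s / s0 by rewrite ler_pdivlMr // mul1r.
  have -> : s / s0 = 2 * (1 / (2 * s0) * s) by field; rewrite gt_eqF.
  by rewrite /r; lra.
have sh : 0 < s - 1 / 2 by lra.
have q1 : (s - 1 / 2) * (1 / q - 1) <= 1.
  have : (1 - (1 / 2 + s)^-1) * (1 / 2 + s) < q * (1 / 2 + s).
    by rewrite ltr_pM2r //; lra.
  rewrite mulrBl mulVf; last by rewrite gt_eqF //; lra.
  move=> h; have -> : (s - 1 / 2) * (1 / q - 1) = (s - 1 / 2) * (1 - q) / q.
    by field; rewrite gt_eqF.
  by rewrite ler_pdivrMr //; lra.
have rsn : r * s * (- ln q) <= 1.
  apply: le_trans q1; apply: le_trans (ler_wpM2l _ lnq); last by exact: ltW.
  by rewrite ler_wpM2r // oppr_ge0 ln_le0 // ltW // (hard_root_lt1 hq).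
rewrite ler_pdivlMr // sk.
have := ler_wpM2l (ltW (mulr_gt0 (ltr0n R 2) s2)) rsn; lra.
Qed.

Lemma hard_solution_near_geom (R : realType) (th : params R) (q e : R) :
  valid_params th -> hard_root th q -> 0 < e ->
  exists N : nat, forall n, (N <= n)%N -> forall xs ys : 'cV[R]_n,
    gradFx th xs ys = 0 -> gradFy th q xs ys = 0 ->
    dot (xs - geom_vec n q) (xs - geom_vec n q) <= e.
Proof.
move=> vth hq e0.
have [N NP] := geometric_small (hard_root_gt0 vth hq) (hard_root_lt1 hq)
  (residual_const th / beta th ^+ 2) e0.
exists (maxn N 5) => n; rewrite geq_max => /andP[Nn n5] xs ys gx gy.
apply: le_trans (NP n Nn); apply: geom_vec_error => //.
exact: stationary_hard_op gx gy.
Qed.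

Theorem theorem4p7 (R : realType) :
  (forall (th : params R) (q : R), valid_params th -> hard_root th q ->
   forall k : nat, (0 < k)%N ->
   exists N : nat, forall n : nat, (N <= n)%N ->
   forall A : algorithm R n n,
   exists U V : 'M[R]_n,
     let G := hard_FUV th q U V in
     [/\ orthogonal_mx U, orthogonal_mx V,
         problem_class th G,
         (forall j : nat, (j <= k)%N ->
            rotated_krylov th q U V (2 * k) (iterate A th G (0, 0) j)) /\
         rotated_krylov th q U V (2 * k + 1) (output A th G (0, 0) k) &
         forall xs ys : 'cV[R]_n, saddle_point (@hard_F R n th q) xs ys ->
           q ^+ (4 * k + 2) / 16 * enorm (xs - 0) ^+ 2
             <= enorm ((output A th G (0, 0) k).1 - U^T *m xs) ^+ 2])
  /\
  (* Iteration lower bound: no output produced within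
     c sqrt(kappa) ln(1/eps) iterations has duality gap at most C eps. Since
     kappa > 2 always holds, and the bound degenerates as kappa tends to 2, the
     constant c is uniform on each region kappa0 <= kappa. *)
  (forall kappa0 : R, 2 < kappa0 ->
   exists c : R, 0 < c /\
   forall (th : params R) (q : R), valid_params th -> hard_root th q ->
   kappa0 <= kappa th ->
   forall C : R, 0 < C ->
   exists eps0 : R, 0 < eps0 /\
   forall eps : R, 0 < eps < eps0 ->
   exists N : nat, forall n : nat, (N <= n)%N ->
   forall A : algorithm R n n,
   exists U V : 'M[R]_n,
     let G := hard_FUV th q U V in
     [/\ orthogonal_mx U, orthogonal_mx V,
         problem_class th G &
         forall j : nat, (0 < j)%N ->
           j%:R <= c * Num.sqrt (kappa th) * ln (eps^-1) ->
           ((C * eps)%:E < duality_gap G (output A th G (0, 0) j)%R)%E]).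
Proof.
split.
  move=> th q vth hq k k0; have q0 := hard_root_gt0 vth hq.
  have q1 := hard_root_lt1 hq.
  (* The accuracy required by [tail_estimate] for [p = 2 * k + 1], the index of the output. *)
  have e0 : 0 < q ^+ (2 * (2 * k + 1)) * (q ^+ 2 / 16).
    by rewrite mulr_gt0 ?divr_gt0 ?exprn_gt0.
  have [N NP] := hard_solution_near_geom vth hq e0.
  exists (maxn N (2 * (2 * k + 1))) => n; rewrite geq_max => /andP[Nn kn] alg.
  have [|U [V [oU oV cls itP outP]]] := @hard_oracle R n th q vth hq k alg.
    by lia.
  exists U, V; split=> //; first split.
  - by move=> j jk; apply: rotated_krylov_le (itP j jk); lia.
  - by apply: outP; rewrite k0 leqnn.
  move=> xs ys /(saddle_stationary)[gx gy].
  have [|[u uE uz] _] := outP k; first by rewrite k0 leqnn.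
  rewrite subr0 -uz -mulmxBr !enorm_sq (orthogonal_dot _ (orthogonal_tr oU)).
  rewrite (_ : (4 * k + 2 = 2 * (2 * k + 1))%N); last by lia.
  apply: tail_estimate => //; first by lia.
    by move=> i ki; apply: krylov_x_nth uE.
  exact: NP gx gy.
move=> kappa0 k0; have [M [M0 lnq]] := ln_hard_root k0.
have c0 : 0 < 1 / (8 * M) by rewrite divr_gt0 // mulr_gt0.
exists (1 / (8 * M)); split=> // th q vth hq kk C C0.
have q0 := hard_root_gt0 vth hq; have q1 := hard_root_lt1 hq.
have mx0 : 0 < mux th by case: vth.
(* The gap at step [j] will be at least [C * t * q ^+ (4 * j)]. Below [t ^+ 2], one square root of
   [eps] absorbs [t] and the other remains for [q ^+ (4 * j)]. *)
pose t := mux th / 8 * q ^+ 4 / C.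
have t0 : 0 < t by rewrite divr_gt0 // mulr_gt0 ?exprn_gt0 // divr_gt0.
exists (t ^+ 2); split=> [|eps /andP[e0 et]]; first by rewrite exprn_gt0.
set X := _ * _ * ln _.
(* One rotation must serve all [j] up to [X], so the oracle is run for [K] steps. *)
have [K XK] : exists K : nat, X < K%:R.
  exists (Num.bound `|X|).
  by apply: le_lt_trans (ler_norm X) _; apply: archi_boundP.
(* Entry [2 * j + 1] of [geom_vec] is [q ^+ (2 * j + 2)]; this accuracy puts the entry of [xs]
   within half of it for every [j <= K]. *)
have d0 : 0 < (q ^+ (2 * K + 2)) ^+ 2 / 4 by rewrite divr_gt0 ?exprn_gt0.
have [N NP] := hard_solution_near_geom vth hq d0.
exists (maxn N (2 * K + 2)) => n; rewrite geq_max => /andP[Nn kn] alg.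
have [|U [V [oU oV cls itP outP]]] := @hard_oracle R n th q vth hq K alg.
  by move: kn; clear; lia.
exists U, V; split=> // j j0 jX.
have jK : (j <= K)%N by rewrite -(ler_nat R) ltW // (le_lt_trans jX).
have [xs [ys [gx gy]]] := @stationary_exists R n th q vth.
apply: lt_le_trans (duality_gap_ge vth _ oU oV gx gy); rewrite lte_fin.
have [|[u uE uz] _] := outP j; first by rewrite j0.
rewrite -uz mulmxA oU mul1mx.
have jn : (2 * j + 1 < n)%N by move: jK kn; clear; lia.
have jK2 : (2 * j + 2 <= 2 * K + 2)%N by move: jK; clear; lia.
set g := q ^+ (2 * j + 2).
(* A single entry suffices here: the first one at which all members of [krylov_x] of index
   [2 * j + 1] vanish. *)
have coord : g ^+ 2 / 4 <= dot (u - xs) (u - xs).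
  apply: le_trans (dot_nth_le (u - xs) (2 * j + 1)).
  rewrite nth_entryD nth_entryN (krylov_x_nth (leqnn _) uE) sub0r sqrrN.
  apply: half_sq_le; first by rewrite exprn_ge0 // ltW.
  have -> : g = nth_entry (geom_vec n q) (2 * j + 1).
    by rewrite nth_geom // /g addn2 addn1.
  rewrite -nth_entryN -nth_entryD; apply: le_trans (dot_nth_le _ _) _.
  apply: le_trans (NP n Nn xs ys gx gy) _; rewrite nth_geom //.
  rewrite ler_pM2r ?invr_gt0 // ler_sqr ?nnegrE ?exprn_ge0 ?(ltW q0) //.
  by apply: ler_wiXn2l; rewrite ?ltW // -addnS.
have Q0 : 0 < q ^+ (4 * j) by rewrite exprn_gt0.
have gE : g ^+ 2 = q ^+ (4 * j) * q ^+ 4.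
  by rewrite -exprM -exprD; congr (q ^+ _); clear; lia.
(* By [lnq], the constant in [X] makes [j <= X] force [eps <= q ^ (8 j)]. *)
have eQ : eps <= (q ^+ (4 * j)) ^+ 2.
  rewrite -ler_ln ?posrE ?exprn_gt0 // -exprM lnXn // -mulr_natr.
  have -> : (4 * j * 2)%:R = 8 * j%:R :> R by rewrite !natrM; ring.
  have := lnq th q vth hq kk; move: jX; rewrite /X lnV ?posrE //.
  have sk0 : 0 < Num.sqrt (kappa th).
    by rewrite sqrtr_gt0; have := kappa_gt2 vth; lra.
  have a0 : 0 <= - ln q by rewrite oppr_ge0 ln_le0 // ltW.
  move: (ln q) (ln eps) (Num.sqrt _) a0 sk0 => l L s l0 s0 jX lM.
  (* A positive [j] below [X] forces [eps] below 1. *)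
  have L0 : 0 < - L.
    rewrite -(pmulr_rgt0 _ (mulr_gt0 c0 s0)); apply: lt_le_trans jX.
    by rewrite ltr0n.
  have h1 := ler_wpM2l l0 jX.
  have h2 := ler_wpM2r (ltW L0) lM.
  have h3 : - l * (1 / (8 * M) * s * - L) <= - L / 8.
    have -> : - l * (1 / (8 * M) * s * - L) = (- l * s * - L) / (8 * M).
      by field; rewrite gt_eqF.
    by rewrite ler_pdivrMr ?mulr_gt0 //; lra.
  by lra.
(* After squaring, this is the product of [eps < t ^+ 2] and [eQ]. *)
have etQ : eps < t * q ^+ (4 * j).
  have tQ0 : 0 <= t * q ^+ (4 * j) by rewrite mulr_ge0 ?(ltW t0) ?(ltW Q0).
  rewrite -(@ltr_pXn2r _ 2) ?nnegrE ?(ltW e0) // exprMn.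
  apply: (@lt_le_trans _ _ (t ^+ 2 * eps)).
    by rewrite [ltLHS]expr2 ltr_pM2r.
  by rewrite ler_pM2l ?exprn_gt0.
rewrite gE in coord.
apply: (@lt_le_trans _ _ (mux th / 2 * (q ^+ (4 * j) * q ^+ 4 / 4))).
  rewrite mulrC -ltr_pdivlMr //.
  have -> : mux th / 2 * (q ^+ (4 * j) * q ^+ 4 / 4) / C = t * q ^+ (4 * j).
    by rewrite /t; field; rewrite gt_eqF.
  exact: etQ.
by rewrite ler_pM2l // divr_gt0.
Qed.
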